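(* Let $M=\mathbb{R}^4\times S^3$ be equipped with the $\mathrm{SU}(2)^3$-invariant coclosed $G_2$-structure determined by $A_1$ (with $A_1=A_2=A_3$) and $b_0>0$ as described in the context, and put $F(t)=-\frac{\dot A_1}{A_1}+\frac1{A_1}-\frac{A_1}{B_1^2}$. For $x_1\ge 0$ let $$\theta^{x_1}=\frac{x_1A_1(t)\,e^{\int_{1/2}^tF(\xi)d\xi}}{1+x_1\int_0^te^{\int_{1/2}^\eta F(\xi)d\xi}d\eta}\sum_{i=1}^3T_i\otimes\eta_i^+,\qquad \theta_0=\frac{A_1(t)\,e^{\int_{1/2}^tF(\xi)d\xi}}{\int_0^te^{\int_{1/2}^\eta F(\xi)d\xi}d\eta}\sum_{i=1}^3T_i\otimes\eta_i^+ .$$ Then: (i) For any $\lambda>0$ there is a family $\delta=\delta(x_1,\lambda)>0$ converging to $0$ as $x_1\to\infty$ such that, for all $p\in S^3$, if we define $$s_\delta^p:B_1\subset\mathbb{R}^4\to B_\delta\times\{p\}\subset\mathbb{R}^4\times S^3,\qquad x\mapsto(\delta x,p),$$ then $(s_\delta^p)^*\theta^{x_1}$ converges uniformly with all derivatives, as $x_1\to\infty$, to the basic anti-self-dual instanton with scale $\lambda$ on $B_1\subset\mathbb{R}^4$, $$\theta_\lambda^{\mathrm{ASD}}=\frac{\lambda t^2}{1+\lambda t^2}\sum_{i=1}^3T_i\otimes\eta_i^+ .$$ (ii) Suppose that $\theta_0$ is bounded. Then the connections $\theta^{x_1}$ converge to $\theta_0$ on every compact subset of $(\mathbb{R}^4\setminus\{0\})\times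 S^3$ as $x_1\to\infty$.
   Context: Manifold. View $M=\mathbb{R}^4\times S^3\subset\mathbb{H}\times\mathbb{H}$ with $\mathrm{SU}(2)^2$ (pairs of unit quaternions) acting by $(a_1,a_2)\cdot(p,q)=(a_1p,a_1q\bar a_2)$. The singular orbit is $S^3=\{0\}\times S^3\cong \mathrm{SU}(2)^2/\Delta\mathrm{SU}(2)$, and its complement is identified with $(0,\infty)\times\mathrm{SU}(2)^2$ by $(t,(a_1,a_2))\mapsto(a_1t,a_1\bar a_2)$, so $t$ is the radial coordinate on $\mathbb{R}^4$. Let $\{T_i\}_{i=1}^3$ be a basis of $\mathfrak{su}(2)$ with $[T_i,T_j]=2\epsilon_{ijk}T_k$ (a ''standard basis''), $T_i^{+}=(T_i,T_i)$, $T_i^-=(T_i,-T_i)$, and let $\eta_i^\pm$ be the dual left-invariant 1-forms on $\mathrm{SU}(2)^2$. A dot denotes $d/dt$. A function on $[0,\infty)$ is called odd (even) if its Taylor expansion at $0$ has only odd (even) powers. $G_2$-structure. Let $A_1:[0,\infty)\to\mathbb{R}$ be smooth, positive on $(0,\infty)$, odd at $0$, with $\dot A_1(0)=1/2$, and let $b_0>0$. Let $B_1$ be the positive smooth function on $[0,\infty)$, even at $0$, with $B_1(0)=b_0$ and $\frac{d}{dt}(A_1^2B_1^2)=A_1^3+A_1B_1^2$. Put $A_i=A_1$, $B_i=B_1$ for $i=1,2,3$. On $(0,\infty)\times \mathrm{SU}(2)^2$ set $\omega=4\sum_iA_iB_i\,\eta_i^-\wedge\eta_i^+$, $\Omega_1=8B_1B_2B_3\,\eta_1^-\wedge\eta_2^-\wedge\eta_3^-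 -8\sum_{cyc}A_iA_jB_k\,\eta_i^+\wedge\eta_j^+\wedge\eta_k^-$, $\Omega_2=-8A_1A_2A_3\,\eta_1^+\wedge\eta_2^+\wedge\eta_3^+ +8\sum_{cyc}B_iB_jA_k\,\eta_i^-\wedge\eta_j^-\wedge\eta_k^+$ (sums over cyclic permutations $(i,j,k)$ of $(1,2,3)$). The $G_2$-structure is $\varphi=dt\wedge\omega+\Omega_1$, with $\psi={*_\varphi}\varphi=\frac12\omega^2-dt\wedge\Omega_2$ and metric $g=dt^2+\sum_i(2A_i)^2\eta_i^+\otimes\eta_i^++\sum_i(2B_i)^2\eta_i^-\otimes\eta_i^-$; it extends smoothly to $M$ and $d\psi=0$. Connections. Away from the singular orbit, connections are written as $\mathfrak{su}(2)$-valued 1-forms in the trivialization of the bundle $(0,\infty)\times\mathrm{SU}(2)^2\times\mathrm{SU}(2)$. The connections $\theta^{x_1}$ are $G_2$-instantons ($F\wedge\psi=0$) extending smoothly to $M$ on the bundle $P_1=\mathrm{SU}(2)^2\times_{(\Delta\mathrm{SU}(2),1)}\mathrm{SU}(2)$ (trivial isotropy homomorphism; pulled back to $M$ from the singular orbit), and $\theta_0$ is a $G_2$-instanton extending smoothly to $M$ on $P_{\mathrm{id}}=\mathrm{SU}(2)^2\times_{(\Delta\mathrm{SU}(2),\mathrm{id})}\mathrm{SU}(2)$. $B_r\subset\mathbb{R}^4$ is the ball of radius $r$ centred at $0$. In the formula for $\theta^{\mathrm{ASD}}_\lambda$, $t=|x|$ on $\mathbb{R}^4$ and $\eta_i^+$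 denotes the restriction of $\eta_i^+$ to $(\mathbb{R}^4\setminus\{0\})\times\{p\}$, i.e. the left-invariant coframe dual to $T_i$ on the unit quaternions $S^3\subset\mathbb{R}^4$, pulled back radially. In (ii), norms are pointwise norms with respect to $g$ and a fixed $\mathrm{Ad}$-invariant norm on $\mathfrak{su}(2)$; ''bounded'' means that $|\theta_0|$ is bounded on the complement of each neighbourhood of the singular orbit, and convergence on a compact set means uniform convergence of the $\mathfrak{su}(2)$-valued 1-forms there. *)

(* Defs.v *)
From HB Require Import structures.
From mathcomp Require Import all_boot all_order all_algebra.
From mathcomp Require Import ring lra.
From mathcomp Require Import all_classical all_reals all_analysis.

Set Implicit Arguments.
Unset Strict Implicit.
Unset Printing Implicit Defensive.

Import Order.TTheory GRing.Theory Num.Theory.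
Import numFieldNormedType.Exports.

Local Open Scope classical_set_scope.
Local Open Scope ring_scope.

(* Quaternions are row vectors of coordinates with respect to 1, i, j, k.  The
   library norm on row vectors is the max norm; [qnorm] is the Euclidean one. *)
Notation quat R := 'rV[R]_4.

Section Quaternions.
Context {R : realType}.
Implicit Types p q : quat R.

Definition mkq (a b c d : R) : quat R := \row_(l < 4) [:: a; b; c; d]`_l.

Definition re p : R := p 0 0.
Definition ci p : R := p 0 1.
Definition cj p : R := p 0 2.
Definition ck p : R := p 0 3.

Definition qmul p q : quat R := mkq
  (re p * re q - ci p * ci q - cj p * cj q - ck p * ck q)
  (re p * ci q + ci p * re q + cj p * ck q - ck p * cj q)
  (re p * cj q - ci p * ck q + cj p * re q + ck p * ci q)
  (re p * ck q + ci p * cj q - cj p * ci q + ck p * re q).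

Definition qconj p : quat R := mkq (re p) (- ci p) (- cj p) (- ck p).

Definition qnorm p : R := Num.sqrt (\sum_(l < 4) p 0 l ^+ 2).

Definition qbracket p q : quat R := qmul p q - qmul q p.

(* The unit quaternions, identified with SU(2); su(2) is then the space of
   imaginary quaternions with the commutator bracket [qbracket]. *)
Definition S3 : set (quat R) := [set q | qnorm q = 1].

Definition su2 : set (quat R) := [set q | re q = 0].

Definition ball4 (r : R) : set (quat R) := [set x | qnorm x < r].

(* A basis of su(2) with [T_i, T_j] = 2 eps_ijk T_k; three free vectors of the
   3-dimensional space [su2] form a basis. *)
Definition standard_basis (T : 3.-tuple (quat R)) : Prop :=
  [/\ forall i, su2 (tnth T i),
      free T,
      qbracket (tnth T 0) (tnth T 1) = 2 *: tnth T 2,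
      qbracket (tnth T 1) (tnth T 2) = 2 *: tnth T 0 &
      qbracket (tnth T 2) (tnth T 0) = 2 *: tnth T 1].

Definition Ad_invariant_norm (N : quat R -> R) : Prop :=
  [/\ forall u, su2 u -> N u = 0 -> u = 0,
      forall (c : R) u, su2 u -> N (c *: u) = `|c| * N u,
      forall u v, su2 u -> su2 v -> N (u + v) <= N u + N v &
      forall a u, S3 a -> su2 u -> N (qmul (qmul a u) (qconj a)) = N u].

End Quaternions.

Section QuaternionAlgebra.
Context {R : realType}.
Implicit Types p q : quat R.

Lemma mkqE (a b c d : R) :
  (re (mkq a b c d) = a) * (ci (mkq a b c d) = b) *
  (cj (mkq a b c d) = c) * (ck (mkq a b c d) = d).
Proof. by rewrite /re /ci /cj /ck !mxE. Qed.

Lemma quatP p q : re p = re q -> ci p = ci q -> cj p = cj q -> ck p = ck q ->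
  p = q.
Proof.
move=> h0 h1 h2 h3; apply/rowP => -[[|[|[|[|//]]]] lt_l4].
- by move: h0; congr (p 0 _ = q 0 _); apply: val_inj.
- by move: h1; congr (p 0 _ = q 0 _); apply: val_inj.
- by move: h2; congr (p 0 _ = q 0 _); apply: val_inj.
- by move: h3; congr (p 0 _ = q 0 _); apply: val_inj.
Qed.

Lemma quatZE (c : R) p :
  (re (c *: p) = c * re p) * (ci (c *: p) = c * ci p) *
  (cj (c *: p) = c * cj p) * (ck (c *: p) = c * ck p).
Proof. by rewrite /re /ci /cj /ck !mxE. Qed.

Lemma quatNE p :
  (re (- p) = - re p) * (ci (- p) = - ci p) *
  (cj (- p) = - cj p) * (ck (- p) = - ck p).
Proof. by rewrite /re /ci /cj /ck !mxE. Qed.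

Lemma qmulA p q r : qmul p (qmul q r) = qmul (qmul p q) r.
Proof. by apply: quatP; rewrite !mkqE; ring. Qed.

Lemma qmulZl c p q : qmul (c *: p) q = c *: qmul p q.
Proof. by apply: quatP; rewrite !(quatZE, mkqE); ring. Qed.

Lemma qmulZr c p q : qmul p (c *: q) = c *: qmul p q.
Proof. by apply: quatP; rewrite !(quatZE, mkqE); ring. Qed.

Lemma qconjM p q : qconj (qmul p q) = qmul (qconj q) (qconj p).
Proof. by apply: quatP; rewrite !mkqE; ring. Qed.

Lemma qconjK p : qconj (qconj p) = p.
Proof. by apply: quatP; rewrite !mkqE ?opprK. Qed.

Lemma qnorm_ge0 p : 0 <= qnorm p. Proof. exact: sqrtr_ge0. Qed.

Lemma sqr_qnorm p :
  qnorm p ^+ 2 = re p ^+ 2 + ci p ^+ 2 + cj p ^+ 2 + ck p ^+ 2.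
Proof.
rewrite sqr_sqrtr ?sumr_ge0// => [|i _]; last exact: sqr_ge0.
rewrite !big_ord_recr big_ord0 /= add0r /re /ci /cj /ck.
by do !congr (_ + _); congr (p 0 _ ^+ 2); apply: val_inj.
Qed.

Lemma qconj_qmul p : qmul (qconj p) p = mkq (qnorm p ^+ 2) 0 0 0.
Proof. by rewrite sqr_qnorm; apply: quatP; rewrite !mkqE; ring. Qed.

Lemma qmul_qconj p : qmul p (qconj p) = mkq (qnorm p ^+ 2) 0 0 0.
Proof. by rewrite sqr_qnorm; apply: quatP; rewrite !mkqE; ring. Qed.

Lemma qmul_scalarl (c : R) p : qmul (mkq c 0 0 0) p = c *: p.
Proof. by apply: quatP; rewrite !(mkqE, quatZE); ring. Qed.

Lemma qmul_scalarr (c : R) p : qmul p (mkq c 0 0 0) = c *: p.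
Proof. by apply: quatP; rewrite !(mkqE, quatZE); ring. Qed.

Lemma qnormZ (c : R) p : qnorm (c *: p) = `|c| * qnorm p.
Proof.
apply/eqP; rewrite -(eqrXn2 (n := 2)) ?mulr_ge0 ?qnorm_ge0// exprMn real_normK ?num_real//.
by apply/eqP; rewrite !sqr_qnorm !quatZE; ring.
Qed.

Lemma S3_qconj_qmul p q : S3 p -> qmul (qconj p) (qmul p q) = q.
Proof.
by move=> p1; rewrite qmulA qconj_qmul (p1 : qnorm p = 1) expr1n qmul_scalarl scale1r.
Qed.

Lemma S3_qmul_qconj p q : S3 p -> qmul p (qmul (qconj p) q) = q.
Proof.
by move=> p1; rewrite qmulA qmul_qconj (p1 : qnorm p = 1) expr1n qmul_scalarl scale1r.
Qed.

End QuaternionAlgebra.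

Section HalfLine.
Context {R : realType}.
Implicit Types (f : R -> R) (t : R).

(* Calculus on [0, +oo[: difference quotients are taken within [0, +oo[, so
   derivatives at 0 are one-sided, and values at negative arguments are
   irrelevant. *)
Definition diff_quot f t : R -> R := fun s => (f s - f t) / (s - t).

Definition hderive f t : R := lim (diff_quot f t @ within `[0, +oo[ t^').

Definition hsmooth f : Prop := forall n t, 0 <= t ->
  cvg (diff_quot (iter n hderive f) t @ within `[0, +oo[ t^').

(* Parity of the Taylor expansion at 0. *)
Definition odd_at0 f : Prop := forall k, iter k.*2 hderive f 0 = 0.
Definition even_at0 f : Prop := forall k, iter k.*2.+1 hderive f 0 = 0.

(* The integral from a to b with the usual sign convention when b < a. *)
Definition oint (a b : R) f : R :=
  if a <= b then Rintegral lebesgue_measure `[a, b] f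
  else - Rintegral lebesgue_measure `[b, a] f.

End HalfLine.

Section Manifold.
Context {R : realType}.
Local Notation H := (quat R).

(* 1-forms on (subsets of) a normed space V with values in X: base point, then
   tangent vector.  Only values on vectors tangent to the manifold at hand are
   meaningful. *)
Definition form1 (V X : Type) := V -> V -> X.

Definition pullback (V W : normedModType R) (X : Type) (f : V -> W)
    (alpha : form1 W X) : form1 V X :=
  fun x v => alpha (f x) ('D_v f x).

(* M = R^4 x S^3 inside H x H. *)
Definition M : set (H * H) := [set z | S3 z.2].
Definition singular_orbit : set (H * H) := [set z | z.1 = 0 /\ S3 z.2].
Definition Mreg : set (H * H) := [set z | z.1 != 0 /\ S3 z.2].

(* The identification of ]0, +oo[ x SU(2)^2 with Mreg and its inverse. *)
Definition polar (y : R * (H * H)) : H * H :=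
  (y.1 *: y.2.1, qmul y.2.1 (qconj y.2.2)).

Definition chart (z : H * H) : R * (H * H) :=
  let a1 := (qnorm z.1)^-1 *: z.1 in (qnorm z.1, (a1, qmul (qconj z.2) a1)).

Lemma polarK (t : R) (a : H * H) : 0 < t -> S3 a.1 -> S3 a.2 ->
  chart (polar (t, a)) = (t, a).
Proof.
case: a => a1 a2 t0 /= s1 s2.
have n1 : qnorm a1 = 1 by [].
rewrite /chart /polar /= qnormZ n1 mulr1 gtr0_norm// scalerA mulVf ?gt_eqF//.
rewrite scale1r; congr (_, (_, _)).
by rewrite qconjM qconjK -qmulA qconj_qmul n1 expr1n qmul_scalarr scale1r.
Qed.

Lemma chartK (z : H * H) : Mreg z -> polar (chart z) = z.
Proof.
case: z => p q [/= p0 s2].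
have qp0 : qnorm p != 0.
  apply: contraNneq p0 => np; apply/eqP/quatP;
  have := sqr_qnorm p; rewrite np expr0n /= => /esym e;
  rewrite /re /ci /cj /ck !mxE -/(re p) -/(ci p) -/(cj p) -/(ck p);
  apply/eqP; rewrite -sqrf_eq0; apply/eqP; nra.
rewrite /polar /chart /= scalerA mulfV// scale1r; congr (_, _).
set a := _ *: p; have na : qnorm a = 1.
  by rewrite /a qnormZ normfV ger0_norm ?qnorm_ge0// mulVf.
by rewrite qconjM qconjK qmulA qmul_qconj na expr1n qmul_scalarl scale1r.
Qed.


(* The basis T_1^+, T_2^+, T_3^+, T_1^-, T_2^-, T_3^- of su(2) + su(2). *)
Definition Tpm (T : 3.-tuple H) : (3 + 3).-tuple (H * H) :=
  [tuple match fintype.split k with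
         | inl i => (tnth T i, tnth T i)
         | inr i => (tnth T i, - tnth T i)
         end | k < 3 + 3].

Definition pairmul (a u : H * H) : H * H := (qmul a.1 u.1, qmul a.2 u.2).
Definition pairconj (a : H * H) : H * H := (qconj a.1, qconj a.2).

(* The left-invariant 1-forms on SU(2)^2 dual to [Tpm T], pulled back to
   ]0, +oo[ x SU(2)^2: indices 0, 1, 2 give eta^+ and 3, 4, 5 give eta^-. *)
Definition eta (T : 3.-tuple H) (k : 'I_(3 + 3)) : form1 (R * (H * H)) R :=
  fun y w => coord (Tpm T) k (pairmul (pairconj y.2) w.2).

Definition eta_plus T (i : 'I_3) := eta T (lshift 3 i).
Definition eta_minus T (i : 'I_3) := eta T (rshift 3 i).

(* f(t) (sum_i T_i (x) eta_i^+) on ]0, +oo[ x SU(2)^2. *)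
Definition conn_plus (T : 3.-tuple H) (f : R -> R) : form1 (R * (H * H)) H :=
  fun y w => f y.1 *: \sum_(i < 3) eta_plus T i y w *: tnth T i.

(* The corresponding 1-form on M, extended by 0 over the singular orbit; this
   is the smooth extension of theta^{x_1} in the trivialization of P_1. *)
Definition on_M (alpha : form1 (R * (H * H)) H) : form1 (H * H) H :=
  fun z w => if z.1 == 0 then 0 else pullback chart alpha z w.

End Manifold.

Section Metric.
Context {R : realType}.
Local Notation H := (quat R).
Variables (A B : R -> R) (T : 3.-tuple H).

Definition metric (y w w' : R * (H * H)) : R :=
  w.1 * w'.1
  + \sum_(i < 3) (2 * A y.1) ^+ 2 * (eta_plus T i y w * eta_plus T i y w')
  + \sum_(i < 3) (2 * B y.1) ^+ 2 * (eta_minus T i y w * eta_minus T i y w').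

(* A [metric]-orthonormal frame (see [frameP]): d/dt and the left-invariant
   fields T_i^+ / (2A), T_i^- / (2B). *)
Definition frame (k : 'I_(1 + (3 + 3))) (y : R * (H * H)) : R * (H * H) :=
  match fintype.split k with
  | inl _ => (1, 0)
  | inr l =>
      let c := match fintype.split l with inl _ => A y.1 | inr _ => B y.1 end in
      (0, (2 * c)^-1 *: pairmul y.2 (tnth (Tpm T) l))
  end.

(* The pointwise norm of an su(2)-valued 1-form with respect to the metric and
   a norm N on su(2). *)
Definition form_norm (N : H -> R) (alpha : form1 (R * (H * H)) H)
    (y : R * (H * H)) : R :=
  Num.sqrt (\sum_k N (alpha y (frame k y)) ^+ 2).

(* Boundedness on the complement of each neighbourhood of the singular orbit. *)
Definition bounded_off_singular (N : H -> R) (alpha : form1 (R * (H * H)) H)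
    : Prop :=
  forall U : set (H * H), open U -> singular_orbit `<=` U ->
  exists C : R, forall z, M z -> ~ U z -> form_norm N alpha (chart z) <= C.

End Metric.

Section FrameTheory.
Context {R : realType}.
Local Notation H := (quat R).

Lemma fst_sum (I : finType) (F : I -> H * H) : (\sum_i F i).1 = \sum_i (F i).1.
Proof. by elim/big_ind2 : _ => // x1 x2 y1 y2 <- <-. Qed.

Lemma snd_sum (I : finType) (F : I -> H * H) : (\sum_i F i).2 = \sum_i (F i).2.
Proof. by elim/big_ind2 : _ => // x1 x2 y1 y2 <- <-. Qed.

Lemma tnth_Tpm_plus (T : 3.-tuple H) (i : 'I_3) :
  tnth (Tpm T) (lshift 3 i) = (tnth T i, tnth T i).
Proof. by rewrite tnth_mktuple (unsplitK (inl i)). Qed.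

Lemma tnth_Tpm_minus (T : 3.-tuple H) (i : 'I_3) :
  tnth (Tpm T) (rshift 3 i) = (tnth T i, - tnth T i).
Proof. by rewrite tnth_mktuple (unsplitK (inr i)). Qed.

Lemma free_Tpm (T : 3.-tuple H) : free T -> free (Tpm T).
Proof.
move=> /freeP fT; apply/freeP => k.
under eq_bigr do rewrite -tnth_nth.
rewrite big_split_ord /= => h.
have hp : \sum_(i < 3) (k (lshift 3 i) + k (rshift 3 i)) *: T`_i = 0.
  have /(congr1 fst) := h; rewrite [LHS]/= !fst_sum => e; rewrite -[RHS]e.
  rewrite -big_split /=; apply: eq_bigr => i _.
  by rewrite tnth_Tpm_plus tnth_Tpm_minus /= scalerDl -tnth_nth.
have hm : \sum_(i < 3) (k (lshift 3 i) - k (rshift 3 i)) *: T`_i = 0.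
  have /(congr1 snd) := h; rewrite [LHS]/= !snd_sum => e; rewrite -[RHS]e.
  rewrite -big_split /=; apply: eq_bigr => i _.
  by rewrite tnth_Tpm_plus tnth_Tpm_minus /= scalerBl scalerN -tnth_nth.
move=> l; have {}hp i := fT _ hp i; have {}hm i := fT _ hm i.
by case: (split_ordP l) => i ->; have := hp i; have := hm i; lra.
Qed.

Lemma eta_Tpm (T : 3.-tuple H) (k l : 'I_(3 + 3)) (y : R * (H * H)) (c : R) s :
  free T -> S3 y.2.1 -> S3 y.2.2 ->
  eta T k y (s, c *: pairmul y.2 (tnth (Tpm T) l)) = c * (l == k)%:R.
Proof.
move=> fT s1 s2; rewrite /eta /pairmul /=.
rewrite !qmulZr !S3_qconj_qmul//.
set u := (X in coord _ _ X); have -> : u = c *: (Tpm T)`_l.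
  by rewrite -tnth_nth.
by rewrite linearZ /= coord_free ?free_Tpm.
Qed.

Lemma eta_dt (T : 3.-tuple H) (k : 'I_(3 + 3)) (y : R * (H * H)) s :
  eta T k y (s, 0) = 0.
Proof.
rewrite /eta /pairmul /=.
have q0 p : qmul p 0 = 0 :> H by apply: quatP; rewrite !mkqE /re /ci /cj /ck !mxE; ring.
by rewrite !q0 (_ : (0, 0) = 0)// linear0.
Qed.

Lemma frameP (A B : R -> R) (T : 3.-tuple H) (y : R * (H * H))
    (k l : 'I_(1 + (3 + 3))) :
  0 < A y.1 -> 0 < B y.1 -> free T -> S3 y.2.1 -> S3 y.2.2 ->
  metric A B T y (frame A B T k y) (frame A B T l y) = (k == l)%:R.
Proof.
move=> A0 B0 fT s1 s2.
have An : A y.1 != 0 by rewrite gt_eqF.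
have Bn : B y.1 != 0 by rewrite gt_eqF.
have E0 (c : R) (F : 'I_3 -> R) : (forall i, F i = 0) -> \sum_(i < 3) c * F i = 0.
  by move=> F0; rewrite big1// => i _; rewrite F0 mulr0.
rewrite /metric /frame; case: (fintype.splitP k) => [k' ek|k' ek];
  case: (fintype.splitP l) => [l' el|l' el] /=.
- rewrite /eta_plus /eta_minus !E0 ?addr0 ?mulr1 => [|i|i]; rewrite ?eta_dt ?mul0r//.
  by rewrite -val_eqE /= ek el !ord1 eqxx.
- rewrite /eta_plus /eta_minus !E0 ?addr0 ?mulr0 => [|i|i]; rewrite ?eta_dt ?mul0r//.
  by rewrite -val_eqE /= ek el ord1.
- rewrite /eta_plus /eta_minus !E0 ?addr0 ?mul0r => [|i|i]; rewrite ?eta_dt ?mulr0//.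
  by rewrite -val_eqE /= ek el ord1.
have -> : (k == l) = (k' == l') by rewrite -!val_eqE /= ek el eqn_add2l.
rewrite mul0r add0r /eta_plus /eta_minus.
under eq_bigr do rewrite !eta_Tpm//.
under [X in _ + X]eq_bigr do rewrite !eta_Tpm//.
have D (c d e : R) (a b : 'I_3) : \sum_(i < 3) c * (d * (a == i)%:R * (e * (b == i)%:R))
    = c * d * e * (a == b)%:R.
  rewrite (bigD1 a)//= big1 ?addr0 => [|i /negPf ia]; last first.
    by rewrite (eq_sym a) ia mulr0 mul0r mulr0.
  by rewrite eqxx mulr1 (eq_sym b); ring.
have lr (i j : 'I_3) : (lshift 3 i == rshift 3 j) = false by rewrite eq_lrshift.
have rl (i j : 'I_3) : (rshift 3 i == lshift 3 j) = false by rewrite eq_rlshift.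
case: (split_ordP k') => a ->; case: (split_ordP l') => b ->;
  rewrite ?(unsplitK (inl _)) ?(unsplitK (inr _)) ?lr ?rl ?eq_lshift ?eq_rshift.
- under eq_bigr do rewrite !eq_lshift.
  rewrite D E0 ?addr0 => [|i]; last by rewrite lr mulr0 mul0r.
  by field.
- by rewrite !E0 ?addr0// => i; rewrite ?lr ?rl ?mulr0 ?mul0r.
- by rewrite !E0 ?addr0// => i; rewrite ?lr ?rl ?mulr0 ?mul0r.
- under [X in _ + X]eq_bigr do rewrite !eq_rshift.
  rewrite D E0 ?add0r => [|i]; last by rewrite rl mulr0 mul0r.
  by field.
Qed.

End FrameTheory.

Section Instantons.
Context {R : realType}.
Local Notation H := (quat R).
Variables (A B : R -> R) (T : 3.-tuple H).

Definition Ffun (t : R) : R := - (hderive A t / A t) + (A t)^-1 - A t / B t ^+ 2.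

Definition expF (t : R) : R := expR (oint 2^-1 t Ffun).

Definition theta (x1 : R) : form1 (R * (H * H)) H :=
  conn_plus T (fun t => x1 * A t * expF t / (1 + x1 * oint 0 t expF)).

Definition theta0 : form1 (R * (H * H)) H :=
  conn_plus T (fun t => A t * expF t / oint 0 t expF).

(* The left-invariant coframe dual to T_i on the unit quaternions, pulled back
   to R^4 minus the origin by x |-> x / |x|. *)
Definition eta_S3 (i : 'I_3) : form1 H R :=
  pullback (fun x : H => (qnorm x)^-1 *: x)
    (fun a b => coord T i (qmul (qconj a) b)).

(* The basic anti-self-dual instanton, extended smoothly by 0 at the origin. *)
Definition theta_ASD (lambda : R) : form1 H H := fun x v =>
  if x == 0 then 0
  else (lambda * qnorm x ^+ 2 / (1 + lambda * qnorm x ^+ 2))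
       *: \sum_(i < 3) eta_S3 i x v *: tnth T i.

Definition s_map (delta : R) (p : H) (x : H) : H * H := (delta *: x, p).

End Instantons.

Section SmoothConvergence.
Context {R : realType}.
Local Notation H := (quat R).

Definition e_ (j : 'I_4) : H := delta_mx 0 j.

Definition iter_partial (js : seq 'I_4) (f : H -> H) : H -> H :=
  foldr (fun j g x => 'D_(e_ j) g x) f js.

(* Differentiability of all iterated partial derivatives: C^oo on an open U. *)
Definition smooth_on (U : set H) (f : H -> H) : Prop :=
  forall js x, U x -> differentiable (iter_partial js f) x.

(* Uniform convergence on U with all derivatives, for su(2)-valued 1-forms on
   an open U in R^4 given by their components on the coordinate frame. *)
Definition cvg_Coo (U : set H) (alpha : R -> form1 H H) (F : set_system R)
    (beta : form1 H H) : Prop :=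
  forall j : 'I_4,
  [/\ \forall s \near F, smooth_on U (fun x => alpha s x (e_ j)),
      smooth_on U (fun x => beta x (e_ j)) &
      forall js : seq 'I_4,
        {uniform U, (fun s => iter_partial js (fun x => alpha s x (e_ j))) @ F
           --> iter_partial js (fun x => beta x (e_ j))}].

End SmoothConvergence.

(* Main.v *)
(** Put s = t^2.  By Whitney's theorem on even functions, A(t) = t a(s) and
    B(t) = b(s) with a, b smooth on [0, oo), so that F(t) = 1/t + t r(s) with r
    smooth.  Integrating twice, both A(t) exp(int F) and int_0^t exp(int F) are s
    times smooth positive functions j(s) and i(s) with j(0) = i(0).  Hence, up to
    the factor |x|^2 contained in the coframe, the coefficient of
    theta^{x_1} at distance t from the singular orbit is
    x_1 j(s) / (1 + x_1 s i(s)).  With delta^2 = lambda / (x_1 i(0)) its pullback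
    under x |-> delta x depends only on |x|^2 and delta^2, is smooth in x, and
    specializes to the anti-self-dual instanton at delta = 0.  Away from the
    singular orbit, theta^{x_1} - theta_0 is of size O(1 / x_1), locally
    uniformly. *)

Require Import Defs.
From mathcomp Require Import all_boot all_order all_algebra.
From mathcomp Require Import ring lra.
From mathcomp Require Import all_classical all_reals all_analysis.
Import Order.TTheory GRing.Theory Num.Theory.
Import numFieldNormedType.Exports.
Local Open Scope classical_set_scope.
Local Open Scope ring_scope.

(** The condition A'(0) = 1/2 acts twice. In F the term 1/A contributes 2/t and -A'/A contributes
    -1/t, so that exp(int F) vanishes to exactly first order at 0. And since ds = 2 t dt, the
    integral of exp(int F) is that of j / (2 a) over s, where 2 a(0) = 1; hence j(0) = i(0), without
    which the rescaled connections would tend to a multiple of the instanton. The coframe is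
    singular at the origin of R^4, but |x|^2 sum_i T_i (x) eta_i^+ is Im(conj(x) dx), which is
    linear in x. Both connections are therefore a scalar function of |x|^2 times a polynomial form.
    The obstacle in (i) is the control of all derivatives at once, for profiles known only through
    their smoothness on a closed half-line. Expressions in x and in the squared scale are made into
    a syntax closed under partial derivatives, so that a single uniform estimate, proved by
    induction on the syntax, serves every order. *)

(** * One-sided differential calculus on the half-line *)

Section HalfLineCalculus.
Context {R : realType}.
Implicit Types (f g : R -> R) (t d : R).

(* One-sided differentiability at 0 is reduced to ordinary differentiability of
   some extension to the whole line. *)
Definition hder f t d :=
  exists2 g, (forall s, 0 <= s -> g s = f s) & is_derive t (1 : R) g d.

Definition hcont f t :=
  exists2 g, (forall s, 0 <= s -> g s = f s) & {for t, continuous g}.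

Lemma hfilter_proper t : 0 <= t -> ProperFilter (within `[0, +oo[ t^').
Proof.
move=> t0; apply: Build_ProperFilter_ex => P PP.
have /filter_ex// : (t^'+) P.
move: PP; rewrite /within /= /at_right !near_withinE; apply: filterS => z Pz tz.
by apply: Pz; rewrite /= ?in_itv/= ?andbT ?gt_eqF// (le_trans t0)// ltW.
Qed.

Lemma hderP f t d : 0 <= t ->
  hder f t d <-> diff_quot f t @ within `[0, +oo[ t^' --> d.
Proof.
move=> t0; split=> [[g gf /is_derive1_caratheodory[q [qE qc <-]]]|fd].
  apply/cvgrPdist_lt => e e0; rewrite /within /= !near_withinE.
  move/cvgrPdist_lt : qc => /(_ e e0); apply: filterS => z qz zt.
  rewrite /= in_itv/= andbT => z0.
  by rewrite /diff_quot -!gf// qE mulfK// subr_eq0.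
(* The affine branch has the slope [d], so it glues differentiably to [f] at 0; for [t > 0] it is
   not met near [t]. *)
pose g (s : R) : R := if s < 0 then f 0 + d * s else f s.
exists g => [s s0|]; first by rewrite /g ltNge s0.
apply/is_derive1_caratheodory.
pose q (z : R) : R := if z == t then d else (g z - g t) / (z - t).
have qt : q t = d by rewrite /q; case: eqP.
have qn z : z != t -> q z = (g z - g t) / (z - t).
  by move=> /negPf zt; rewrite /q zt.
have gt : g t = f t by rewrite /g ltNge t0.
exists q; split => //; last first.
  rewrite /prop_for /continuous_at qt; apply/cvgrPdist_lt => e e0.
  move/cvgrPdist_lt : fd => /(_ e e0); rewrite /within /= !near_withinE.
  have nz : \forall z \near t, 0 < t -> 0 <= z.
    have [->|tn0] := eqVneq t 0; first by near=> z; rewrite ltxx.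
    have tp : 0 < t by rewrite lt_neqAle eq_sym tn0.
    by near=> z => _; apply/ltW; near: z; exact: lt_nbhsr.
  move=> fd; near=> z.
  have [->|zt] := eqVneq z t; first by rewrite qt subrr normr0.
  rewrite qn// gt; have [z0|z0] := leP 0 z.
    rewrite /g [z < 0]ltNge z0 /=; move: zt z0.
    rewrite -[_ / _]/(diff_quot f t z).
    have : z != t -> `[0, +oo[%classic z -> `|d - diff_quot f t z| < e by near: z.
    by move=> + zt z0; apply => //=; rewrite in_itv/= z0.
  have te : t = 0.
    apply/eqP; rewrite eq_le t0 andbT leNgt; apply/negP => tp.
    have : 0 < t -> 0 <= z by near: z.
    by rewrite leNgt z0 => /(_ tp).
  rewrite te /g z0 !subr0 addrAC subrr add0r mulfK ?subrr ?normr0//.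
  by rewrite lt_eqF.
move=> z; have [->|zt] := eqVneq z t; first by rewrite !subrr mulr0.
by rewrite qn// divfK// subr_eq0.
Unshelve. all: by end_near. Qed.

Lemma hder_uniq f t d : 0 <= t -> hder f t d -> hderive f t = d.
Proof.
move=> t0 /(hderP _ _ _ t0) fd; have := hfilter_proper _ t0.
by move=> ?; apply: cvg_lim.
Qed.

Lemma eq_hder f g t d : (forall s, 0 <= s -> f s = g s) ->
  hder f t d -> hder g t d.
Proof. by move=> fg [h hf dh]; exists h => // s s0; rewrite hf// fg. Qed.

Lemma eq_hderive f g t : (forall s, 0 <= s -> f s = g s) -> 0 <= t ->
  hderive f t = hderive g t.
Proof.
move=> fg t0; rewrite /hderive; congr (lim _).
have E s : 0 <= s -> diff_quot f t s = diff_quot g t s.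
  by move=> s0; rewrite /diff_quot !fg.
by rewrite eqEsubset; split; apply: near_eq_cvg;
  rewrite /within /= near_withinE; near=> s;
  rewrite /= in_itv/= andbT => s0; rewrite E.
Unshelve. all: by end_near. Qed.

Lemma is_derive_hder f t d : is_derive t (1 : R) f d -> hder f t d.
Proof. by exists f. Qed.

Lemma hder_is_derive f t d : 0 < t -> hder f t d -> is_derive t (1 : R) f d.
Proof.
move=> t0 [g gf]; apply: near_eq_is_derive; near=> s; apply: gf.
by apply/ltW; near: s; exact: lt_nbhsr.
Unshelve. all: by end_near. Qed.

Lemma hder_hcont f t d : hder f t d -> hcont f t.
Proof.
move=> [g gf [dg _]]; exists g => //.
by apply: differentiable_continuous; exact/derivable1_diffP.
Qed.

Lemma hder_cst (c : R) t : hder (fun=> c) t 0.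
Proof. by apply: is_derive_hder. Qed.

Lemma hderD f g t d e : hder f t d -> hder g t e ->
  hder (fun s => f s + g s) t (d + e).
Proof.
move=> [f1 ff df] [g1 gg dg]; exists (f1 + g1); last exact: is_deriveD.
by move=> s s0; rewrite fctE ff// gg.
Qed.

Lemma hderM f g t d e : 0 <= t -> hder f t d -> hder g t e ->
  hder (fun s => f s * g s) t (d * g t + f t * e).
Proof.
move=> t0 [f1 ff df] [g1 gg dg]; exists (f1 * g1).
  by move=> s s0; rewrite fctE ff// gg.
by apply: is_derive_eq; rewrite -ff// -gg// /GRing.scale /=; ring.
Qed.

Lemma hderV f t d : 0 <= t -> f t != 0 -> hder f t d ->
  hder (fun s => (f s)^-1) t (- (f t) ^- 2 * d).
Proof.
move=> t0 ft [g gf dg]; exists (fun s => (g s)^-1).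
  by move=> s s0; rewrite gf.
by rewrite -gf//; apply: is_deriveV; rewrite ?gf.
Qed.

Lemma hder_comp f g t d e : 0 <= t -> is_derive (f t) (1 : R) g e ->
  hder f t d -> hder (fun s => g (f s)) t (e * d).
Proof.
move=> t0 dg [f1 ff df]; exists (g \o f1) => [s s0|] /=; first by rewrite ff.
by apply: is_derive1_comp; rewrite ff.
Qed.

Lemma hder_compr f g t d e : 0 <= f t -> (forall s, 0 <= s -> 0 <= f s) ->
  hder g (f t) e -> 0 <= t -> hder f t d -> hder (fun s => g (f s)) t (e * d).
Proof.
move=> ft0 f0 [g1 gg dg] t0 fd.
by apply: (eq_hder (fun s => g1 (f s))) => [s s0|]; rewrite ?gg ?f0//;
  exact: hder_comp.
Qed.

Lemma hsmooth_hder f t : hsmooth f -> 0 <= t -> hder f t (hderive f t).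
Proof. by move=> sf t0; apply/hderP => //; exact: (sf 0%N). Qed.

Lemma hsmooth_hderive f : hsmooth f -> hsmooth (hderive f).
Proof. by move=> sf n; rewrite -iterSr; exact: sf. Qed.

(** Derivatives are existential witnesses instead of iterates of [hderive]: closure under an
    operation is then one induction on [n] using the rules for [hder], with no limit to evaluate. *)
Fixpoint Cn n f : Prop :=
  if n is m.+1 then
    exists2 f', (forall t, 0 <= t -> hder f t (f' t)) & Cn m f'
  else True.

Lemma eq_iter_hderive n f g t : (forall s, 0 <= s -> f s = g s) -> 0 <= t ->
  iter n hderive f t = iter n hderive g t.
Proof.
move=> fg; elim: n t => [|n IH] t t0; first exact: fg.
exact: eq_hderive.
Qed.

Lemma hsmoothP f : hsmooth f <-> forall n, Cn n f.
Proof.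
split=> [sf n|Cf n t t0].
  elim: n f sf => // n IH f sf; exists (hderive f); last exact/IH/hsmooth_hderive.
  by move=> t; exact: hsmooth_hder.
suff [d fd] : exists d, hder (iter n hderive f) t d.
  by apply/cvg_ex; exists d; apply/hderP.
move: {Cf}(Cf n.+1); elim: n f => [|n IH] f /=.
  by case=> f' ff' _; exists (f' t); exact: ff'.
case=> f' ff' /IH [d fd]; exists d; rewrite -iterS iterSr.
apply: eq_hder fd => s s0; apply: eq_iter_hderive => // r r0.
by apply/esym/hder_uniq => //; exact: ff'.
Qed.

Lemma eq_Cn n f g : (forall s, 0 <= s -> f s = g s) -> Cn n f -> Cn n g.
Proof.
case: n => // n fg [f' ff' Cf']; exists f' => // t t0.
by apply: eq_hder (ff' t t0).
Qed.

Lemma CnW n f : Cn n.+1 f -> Cn n f.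
Proof.
elim: n f => // n IH f [f' ff' Cf']; exists f' => //; exact: IH.
Qed.

Lemma Cn_cst n (c : R) : Cn n (fun=> c).
Proof.
elim: n c => // n IH c; exists (fun=> 0); last exact: IH.
by move=> t _; exact: hder_cst.
Qed.

Lemma CnD n f g : Cn n f -> Cn n g -> Cn n (fun s => f s + g s).
Proof.
elim: n f g => // n IH f g [f' ff' Cf'] [g' gg' Cg'].
exists (fun s => f' s + g' s); last exact: IH.
by move=> t t0; apply: hderD; [exact: ff'|exact: gg'].
Qed.

Lemma CnM n f g : Cn n f -> Cn n g -> Cn n (fun s => f s * g s).
Proof.
elim: n f g => // n IH f g /[dup] Cf [f' ff' Cf'] /[dup] Cg [g' gg' Cg'].
exists (fun s => f' s * g s + f s * g' s); last first.
  by apply: CnD; apply: IH => //; exact: CnW.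
by move=> t t0; apply: hderM; [|exact: ff'|exact: gg'].
Qed.

Lemma CnV n f : (forall s, 0 <= s -> f s != 0) -> Cn n f ->
  Cn n (fun s => (f s)^-1).
Proof.
move=> fn0; elim: n => // n IH /[dup] Cf [f' ff' Cf'].
exists (fun s => - (f s) ^- 2 * f' s).
  by move=> t t0; apply: hderV; [|exact: fn0|exact: ff'].
have C1 := IH (CnW _ _ Cf).
apply: (eq_Cn _ (fun s => -1 * ((f s)^-1 * (f s)^-1 * f' s))).
  by move=> s s0; rewrite expr2 invfM; ring.
by apply: CnM; [exact: Cn_cst|apply: CnM => //; exact: CnM].
Qed.

Lemma Cn_expR n f : Cn n f -> Cn n (fun s => expR (f s)).
Proof.
elim: n => // n IH /[dup] Cf [f' ff' Cf'].
exists (fun s => expR (f s) * f' s).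
  by move=> t t0; apply: hder_comp => //; exact: ff'.
by apply: CnM => //; apply: IH; exact: CnW.
Qed.

Lemma hsmooth_cst (c : R) : hsmooth (fun=> c).
Proof. by apply/hsmoothP => n; exact: Cn_cst. Qed.

Lemma hsmoothD f g : hsmooth f -> hsmooth g -> hsmooth (fun s => f s + g s).
Proof. by move=> /hsmoothP sf /hsmoothP sg; apply/hsmoothP => n; exact: CnD. Qed.

Lemma hsmoothM f g : hsmooth f -> hsmooth g -> hsmooth (fun s => f s * g s).
Proof. by move=> /hsmoothP sf /hsmoothP sg; apply/hsmoothP => n; exact: CnM. Qed.

Lemma hsmoothV f : (forall s, 0 <= s -> f s != 0) -> hsmooth f ->
  hsmooth (fun s => (f s)^-1).
Proof. by move=> f0 /hsmoothP sf; apply/hsmoothP => n; exact: CnV. Qed.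

Lemma hsmooth_expR f : hsmooth f -> hsmooth (fun s => expR (f s)).
Proof. by move=> /hsmoothP sf; apply/hsmoothP => n; exact: Cn_expR. Qed.

Lemma hsmooth_hcont f t : hsmooth f -> 0 <= t -> hcont f t.
Proof. by move=> sf t0; apply: hder_hcont; exact: hsmooth_hder. Qed.

Lemma hsmooth_primitive f f' : (forall t, 0 <= t -> hder f t (f' t)) ->
  hsmooth f' -> hsmooth f.
Proof.
move=> ff' /hsmoothP sf'; apply/hsmoothP => -[//|n].
by exists f' => //; exact: sf'.
Qed.

End HalfLineCalculus.

(** * Mean value theorem and primitives up to the endpoint 0 *)

Section Primitives.
Context {R : realType}.
Implicit Types (f g phi : R -> R) (t d : R) (n : nat).
Local Notation mu := (@lebesgue_measure R).

Lemma hcont0P f :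
  hcont f 0 <-> f s @[s --> 0^'+] --> f 0.
Proof.
split=> [[g gf]|cf].
  rewrite /prop_for /continuous_at -gf// => /cvg_at_right_filter; apply: cvg_trans.
  apply: near_eq_cvg; near=> s; apply: gf; apply/ltW; near: s; exact: nbhs_right_gt.
exists (fun s => if s < 0 then f 0 else f s) => [s s0|]; first by rewrite ltNge s0.
rewrite /prop_for /continuous_at ltxx; apply/cvgrPdist_lt => e e0.
move/cvgrPdist_lt : cf => /(_ e e0); rewrite /at_right near_withinE => cf.
near=> s; case: (ltgtP s 0) => [_|s0|->]; rewrite ?subrr ?normr0//.
have : 0 < s -> `|f 0 - f s| < e by near: s.
exact.
Unshelve. all: by end_near. Qed.

Lemma hcont_continuous f t : 0 < t -> hcont f t -> {for t, continuous f}.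
Proof.
move=> t0 [g gf]; rewrite /prop_for /continuous_at gf ?ltW//.
apply: cvg_trans; apply: near_eq_cvg; near=> s; apply: gf.
by apply/ltW; near: s; exact: lt_nbhsr.
Unshelve. all: by end_near. Qed.

Lemma hcontM f g t : hcont f t -> hcont g t -> hcont (fun s => f s * g s) t.
Proof.
move=> [f1 ff cf] [g1 gg cg]; exists (fun s => f1 s * g1 s).
  by move=> s s0; rewrite ff// gg.
exact: continuousM.
Qed.

Lemma hcont_cst (c : R) t : hcont (fun=> c) t.
Proof. by exists (fun=> c) => //; exact: cst_continuous. Qed.

Lemma hcontX n t : hcont (fun s => s ^+ n) t.
Proof. by exists (fun s => s ^+ n) => //; exact: exprn_continuous. Qed.

Lemma hMVT f f' (b : R) : 0 < b -> (forall t, 0 < t -> hder f t (f' t)) ->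
  hcont f 0 -> exists2 c, 0 < c < b & f b - f 0 = f' c * b.
Proof.
move=> b0 ff' cf.
have [||c] := @MVT R f f' 0 b b0.
- by move=> x; rewrite in_itv/= => /andP[x0 _]; apply: hder_is_derive; [|exact: ff'].
- apply: derivable_oo_LRcontinuous_within; split.
  + move=> x; rewrite in_itv/= => /andP[x0 _].
    by have [] := hder_is_derive _ _ _ x0 (ff' x x0).
  + exact/hcont0P.
  + apply: cvg_at_left_filter.
    by apply: hcont_continuous => //; apply: hder_hcont; exact: ff'.
by rewrite in_itv/= subr0; exists c.
Qed.

(** By the mean value theorem a difference quotient at 0 is a value of [f'] at a nearby point, so it
    inherits the limit of [f']. This gives the derivative at 0 of functions whose formula
    degenerates there. *)
Lemma hder_at0 f f' : (forall t, 0 < t -> hder f t (f' t)) ->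
  hcont f 0 -> hcont f' 0 -> hder f 0 (f' 0).
Proof.
move=> ff' cf /hcont0P cf'; apply/hderP => //.
apply/cvgrPdist_lt => e e0.
move/cvgrPdist_lt : cf' => /(_ e e0); rewrite /at_right near_withinE.
move=> [r /= r0 H]; rewrite /within /= !near_withinE; near=> t => tn0.
rewrite /= in_itv/= andbT => t0.
have tp : 0 < t by rewrite lt_neqAle eq_sym tn0.
have [c /andP[c0 ct] E] := hMVT _ _ _ tp ff' cf.
rewrite /diff_quot E subr0 mulfK//; apply: H => //=.
rewrite sub0r normrN gtr0_norm// (lt_trans ct)//.
by near: t; exact: lt_nbhsl.
Unshelve. all: by end_near. Qed.

Lemma hder_eq f g f' t : (forall s, 0 <= s -> hder f s (f' s)) ->
  (forall s, 0 <= s -> hder g s (f' s)) -> f 0 = g 0 -> 0 <= t -> f t = g t.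
Proof.
move=> ff gg fg0; rewrite le_eqVlt => /predU1P[<-//|t0].
have D s : 0 <= s -> hder (fun s => f s + -1 * g s) s 0.
  move=> s0.
  have -> : 0 = f' s + (0 * g s + -1 * f' s) by ring.
  apply: hderD; first exact: ff.
  by apply: hderM => //; [exact: hder_cst|exact: gg].
have [|c _] := hMVT _ (fun=> 0) _ t0 (fun s s0 => D s (ltW s0)).
  by apply: hder_hcont; exact: D.
by move: fg0; lra.
Qed.

(* The base point -1 makes 0 an interior point of the domain of integration. *)
Definition prim phi t : R :=
  (\int[mu]_(s in `[-1, t]) phi (Num.max 0 s)
   - \int[mu]_(s in `[-1, 0]) phi (Num.max 0 s))%R.

Lemma prim0 phi : prim phi 0 = 0. Proof. exact: subrr. Qed.

Lemma hcont_max phi : (forall t, 0 <= t -> hcont phi t) ->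
  continuous (fun s : R => phi (Num.max 0 s)).
Proof.
move=> cphi t; have m0 : 0 <= Num.max 0 t by rewrite le_max lexx.
have [g gphi cg] := cphi _ m0.
have -> : (fun s : R => phi (Num.max 0 s)) = g \o (fun s : R => Num.max 0 s).
  by apply/funext => s /=; rewrite gphi// le_max lexx.
apply: continuous_comp cg.
by apply: (@continuous_max _ _ (fun=> 0) id); [exact: cst_continuous|exact: cvg_id].
Qed.

Lemma hder_prim phi t : (forall t, 0 <= t -> hcont phi t) -> 0 <= t ->
  hder (prim phi) t (phi t).
Proof.
move=> cphi t0; apply: is_derive_hder.
have c := hcont_max _ cphi.
have t1 : -1 < t by lra.
have tt : t < t + 1 by rewrite ltrDl.
have [|d1 d2] := continuous_FTC1_closed tt _ t1 (c t).
  apply: continuous_compact_integrable; first exact: segment_compact.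
  exact: continuous_subspaceT.
rewrite -[phi t]subr0; apply: is_deriveB.
by apply: DeriveDef => //; rewrite -derive1E d2 max_r.
Qed.

End Primitives.

(** * Hadamard quotients, parity, and even functions of the square root *)

Section EvenOdd.
Context {R : realType}.
Implicit Types (f g phi : R -> R) (t d : R) (n : nat).

Lemma hder_exprn n t : hder (fun s => s ^+ n.+1) t (n.+1%:R * t ^+ n).
Proof.
apply: is_derive_hder; split; first exact: exprn_derivable.
by rewrite exp_derive /GRing.scale /= mulr1.
Qed.

(* [mean n phi t] is the integral of [u ^+ n * phi (t * u)] over u in [0, 1]:
   differentiating under this integral sign raises n and differentiates phi. *)
Definition mean n phi t : R :=
  if t == 0 then phi 0 / n.+1%:R
  else prim (fun s => s ^+ n * phi s) t / t ^+ n.+1.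

Lemma mean_hcont0 n phi : (forall t, 0 <= t -> hcont phi t) ->
  hcont (mean n phi) 0.
Proof.
move=> cphi; apply/hcont0P.
have cX t : 0 <= t -> hcont (fun s => s ^+ n * phi s) t.
  by move=> t0; apply: hcontM; [exact: hcontX|exact: cphi].
have n0 : n.+1%:R != 0 :> R by rewrite pnatr_eq0.
apply/cvgrPdist_lt => e e0.
have /cvgrPdist_lt/(_ e e0) := (hcont0P _).1 (cphi 0 (lexx 0)).
rewrite /at_right !near_withinE => -[r /= r0 H].
near=> t => t0; rewrite /mean eqxx gt_eqF//.
(* Subtracting the mean of the constant [phi 0] leaves a primitive of [s ^+ n * (phi s - phi 0)];
   the mean value theorem bounds it by the oscillation of [phi] near 0. *)
pose G s := prim (fun s => s ^+ n * phi s) s + - (phi 0 / n.+1%:R) * s ^+ n.+1.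
have dG s : 0 <= s -> hder G s (s ^+ n * (phi s - phi 0)).
  move=> s0; have -> : s ^+ n * (phi s - phi 0) =
    s ^+ n * phi s + (0 * s ^+ n.+1 + - (phi 0 / n.+1%:R) * (n.+1%:R * s ^+ n)).
    by field; rewrite -natr1 in n0 *; rewrite addrC.
  apply: hderD; first exact: hder_prim.
  apply: hderM => //; first exact: hder_cst.
  exact: hder_exprn.
have [|c /andP[c0 ct]] := hMVT _ _ _ t0 (fun s s0 => dG s (ltW s0)).
  by apply: hder_hcont; exact: dG.
rewrite /G prim0 expr0n mulr0 addr0 subr0 => E.
have tn : t ^+ n.+1 != 0 by rewrite expf_neq0// gt_eqF.
have -> : phi 0 / n.+1%:R - prim (fun s => s ^+ n * phi s) t / t ^+ n.+1
    = (c / t) ^+ n * (phi 0 - phi c).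
  apply: (mulIf tn); rewrite mulrBl divfK//.
  rewrite expr_div_n exprS.
  have -> : c ^+ n / t ^+ n * (phi 0 - phi c) * (t * t ^+ n) =
     - (c ^+ n * (phi c - phi 0) * t).
    by field; rewrite expf_neq0// gt_eqF.
  by rewrite -E exprS; ring.
rewrite normrM (@le_lt_trans _ _ `|phi 0 - phi c|)//.
  rewrite ler_piMl// normrX exprn_ile1// normrM normfV !gtr0_norm//.
  by rewrite ler_pdivrMr// mul1r ltW.
apply: H => //=.
rewrite sub0r normrN gtr0_norm// (lt_trans ct)//.
by near: t; exact: lt_nbhsl.
Unshelve. all: by end_near. Qed.

(** For positive arguments this is the quotient rule together with an integration by parts; at 0 it
    follows by passing to the limit, both means being continuous there. *)
Lemma hder_mean n phi t : hsmooth phi -> 0 <= t ->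
  hder (mean n phi) t (mean n.+1 (hderive phi) t).
Proof.
move=> sphi.
have cphi s : 0 <= s -> hcont phi s by move=> s0; exact: hsmooth_hcont.
have cphi' s : 0 <= s -> hcont (hderive phi) s.
  by move=> s0; apply: hsmooth_hcont => //; exact: hsmooth_hderive.
suff D s : 0 < s -> hder (mean n phi) s (mean n.+1 (hderive phi) s).
  rewrite le_eqVlt => /predU1P[<-|]; last exact: D.
  by apply: hder_at0 => //; exact: mean_hcont0.
move=> s0; have s00 := ltW s0; have sn0 : s != 0 by rewrite gt_eqF.
have cX m psi r : (forall s, 0 <= s -> hcont psi s) -> 0 <= r ->
    hcont (fun s => s ^+ m * psi s) r.
  by move=> cpsi r0; apply: hcontM; [exact: hcontX|exact: cpsi].
set P := prim (fun s => s ^+ n * phi s).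
have dP r : 0 <= r -> hder P r (r ^+ n * phi r).
  by move=> r0; apply: hder_prim => // u u0; exact: cX.
(* Integration by parts, obtained by comparing derivatives and values at 0. *)
have PE r : 0 <= r -> prim (fun s => s ^+ n.+1 * hderive phi s) r
    = r ^+ n.+1 * phi r + - n.+1%:R * P r.
  move=> r0; apply: (hder_eq _ (fun r => r ^+ n.+1 * phi r + - n.+1%:R * P r)
    (fun r => r ^+ n.+1 * hderive phi r)) r0.
  - by move=> u u0; apply: hder_prim => // v v0; exact: cX.
  - move=> u u0; have -> : u ^+ n.+1 * hderive phi u =
      (n.+1%:R * u ^+ n * phi u + u ^+ n.+1 * hderive phi u)
      + (0 * P u + - n.+1%:R * (u ^+ n * phi u)) by ring.
    apply: hderD; apply: hderM => //.
    + exact: hder_exprn.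
    + exact: hsmooth_hder.
    + exact: hder_cst.
    + exact: dP.
  - by rewrite /P !prim0 expr0n mul0r mulr0 addr0.
have : hder (fun s => P s * (s ^+ n.+1)^-1) s (mean n.+1 (hderive phi) s).
  rewrite /mean (negPf sn0) PE//.
  have -> : (s ^+ n.+1 * phi s + - n.+1%:R * P s) / s ^+ n.+2 =
     s ^+ n * phi s * (s ^+ n.+1)^-1
     + P s * (- (s ^+ n.+1) ^- 2 * (n.+1%:R * s ^+ n)).
    by rewrite !exprS; field; rewrite sn0 expf_neq0.
  apply: hderM => //; first exact: dP.
  apply: hderV; rewrite ?expf_neq0//; exact: hder_exprn.
move=> /(hder_is_derive _ _ _ s0) d; apply: is_derive_hder.
apply: near_eq_is_derive d; near=> r; rewrite /mean gt_eqF//.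
by near: r; exact: lt_nbhsr.
Unshelve. all: by end_near. Qed.

Lemma hsmooth_mean n phi : hsmooth phi -> hsmooth (mean n phi).
Proof.
move=> sphi; apply/hsmoothP => m; elim: m n phi sphi => // m IH n phi sphi.
exists (mean n.+1 (hderive phi)); last exact/IH/hsmooth_hderive.
by move=> t t0; exact: hder_mean.
Qed.

(** At [t = 0] the right-hand side is [iter m hderive phi 0 / (n + m).+1%:R], so taking means
    preserves the parity of Taylor expansions. *)
Lemma iter_hderive_mean m n phi t : hsmooth phi -> 0 <= t ->
  iter m hderive (mean n phi) t = mean (n + m) (iter m hderive phi) t.
Proof.
elim: m n phi t => [|m IH] n phi t sphi t0; first by rewrite addn0.
rewrite iterSr (eq_iter_hderive _ _ (mean n.+1 (hderive phi)))//.
  by rewrite IH// ?addSnnS -?iterSr//; exact: hsmooth_hderive.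
by move=> s s0; apply: hder_uniq => //; exact: hder_mean.
Qed.

Lemma hadamard g t : hsmooth g -> 0 <= t ->
  g t = g 0 + t * mean 0 (hderive g) t.
Proof.
move=> sg; rewrite le_eqVlt => /predU1P[<-|t0]; first by rewrite mul0r addr0.
rewrite /mean gt_eqF// expr1 mulrC divfK ?gt_eqF//.
have sg' := hsmooth_hderive _ sg.
have E : (fun s : R => s ^+ 0 * hderive g s) = hderive g.
  by apply/funext => s; rewrite expr0 mul1r.
rewrite E.
apply: (hder_eq g (fun s => g 0 + prim (hderive g) s) (hderive g)) (ltW t0).
- by move=> s s0; exact: hsmooth_hder.
- move=> s s0; rewrite -[hderive g s]add0r; apply: hderD; first exact: hder_cst.
  by apply: hder_prim => // r r0; exact: hsmooth_hcont.
- by rewrite prim0 addr0.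
Qed.

(* Whitney's theorem on even functions: the derivative of [g \o sqrt] is half
   of [g' t / t = mean 0 g''], which is again smooth and even. *)
Lemma hsmooth_even_sqrt g : hsmooth g -> even_at0 g ->
  hsmooth (fun s => g (Num.sqrt s)).
Proof.
move=> sg eg; apply/hsmoothP => n; elim: n g sg eg => // n IH g sg eg.
have sg' := hsmooth_hderive _ sg; have sg'' := hsmooth_hderive _ sg'.
have sq : hsmooth (mean 0 (hderive (hderive g))) by exact: hsmooth_mean.
exists (fun s => 2^-1 * mean 0 (hderive (hderive g)) (Num.sqrt s)); last first.
  apply: CnM; first exact: Cn_cst.
  apply: IH => // k; rewrite iter_hderive_mean//.
  by rewrite /mean eqxx -!iterSr (eg k.+1) mul0r.
have csqrt h : hcont h 0 -> hcont (fun s => h (Num.sqrt s)) 0.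
  move=> [h1 hh ch]; exists (h1 \o Num.sqrt) => [s s0|].
    by rewrite /= hh// sqrtr_ge0.
  by apply: continuous_comp; [exact: sqrt_continuous|rewrite sqrtr0].
(* The chain rule breaks down at 0, where the square root is not differentiable; there the
   derivative is recovered as a limit by [hder_at0]. *)
suff D s : 0 < s -> hder (fun s => g (Num.sqrt s)) s
    (2^-1 * mean 0 (hderive (hderive g)) (Num.sqrt s)).
  move=> t; rewrite le_eqVlt => /predU1P[<-|]; last exact: D.
  apply: (hder_at0 _
    (fun s => 2^-1 * mean 0 (hderive (hderive g)) (Num.sqrt s))) => //.
    by apply: csqrt; exact: hsmooth_hcont.
  apply: hcontM; first exact: hcont_cst.
  by apply: csqrt; exact: hsmooth_hcont.
move=> s0; have q0 : 0 < Num.sqrt s by rewrite sqrtr_gt0.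
have -> : 2^-1 * mean 0 (hderive (hderive g)) (Num.sqrt s) =
    hderive g (Num.sqrt s) * (2 * Num.sqrt s)^-1.
  rewrite (hadamard (hderive g) (Num.sqrt s))// ?(ltW q0)//.
  by rewrite [hderive g 0](eg 0%N) add0r; field; rewrite gt_eqF.
apply: (hder_compr Num.sqrt g) ; rewrite ?sqrtr_ge0 ?(ltW s0)//.
- by apply: hsmooth_hder => //; exact: sqrtr_ge0.
- by apply: is_derive_hder; exact: is_derive1_sqrt.
Qed.

End EvenOdd.

(** * The fundamental theorem of calculus for oriented integrals *)

Section OrientedIntegrals.
Context {R : realType}.
Implicit Types (f F phi : R -> R) (a b t : R).
Local Notation mu := (@lebesgue_measure R).

Lemma Rintegral_FTC f F a b : a <= b ->
  (forall t, a <= t <= b -> is_derive t (1 : R) F (f t)) ->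
  (forall t, a <= t <= b -> {for t, continuous f}) ->
  (\int[mu]_(t in `[a, b]) f t)%R = F b - F a.
Proof.
rewrite le_eqVlt => /predU1P[<- _ _|ab dF cf].
  by rewrite set_itv1 Rintegral_set1 subrr.
have cF t : a <= t <= b -> {for t, continuous F}.
  move=> /dF[d _]; exact/differentiable_continuous/derivable1_diffP.
rewrite /Rintegral (@continuous_FTC2 _ f F)//.
- apply: continuous_in_subspaceT => x; rewrite inE/= in_itv/=; exact: cf.
- split=> [x||].
  + by rewrite in_itv/= => /andP[/ltW ax /ltW xb]; have [|] := dF x; rewrite ?ax.
  + by apply: cvg_at_right_filter; apply: cF; rewrite lexx ltW.
  + by apply: cvg_at_left_filter; apply: cF; rewrite lexx ltW.
- move=> x; rewrite in_itv/= => /andP[/ltW ax /ltW xb].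
  by rewrite derive1E; have [|_] := dF x; rewrite ?ax.
Qed.

Lemma oint_FTC f F a b : 0 < a -> 0 < b ->
  (forall t, 0 < t -> is_derive t (1 : R) F (f t)) ->
  (forall t, 0 < t -> {for t, continuous f}) ->
  oint a b f = F b - F a.
Proof.
move=> a0 b0 dF cf; rewrite /oint; case: leP => [ab|/ltW ba].
  apply: Rintegral_FTC => // t /andP[ta _]; [apply: dF|apply: cf];
    exact: lt_le_trans ta.
rewrite -opprB; congr (- _).
apply: Rintegral_FTC => // t /andP[bt _]; [apply: dF|apply: cf];
  exact: lt_le_trans bt.
Qed.

(** The integrand is prescribed only on positive arguments because [expF] at 0 is the exponential of
    a divergent integral, hence a convention; a single point does not affect the integral. *)
Lemma oint0_FTC f F phi t : 0 <= t ->
  (forall s, 0 <= s -> hder F s (phi s)) ->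
  (forall s, 0 <= s -> hcont phi s) ->
  (forall s, 0 < s -> f s = phi s) ->
  oint 0 t f = F t - F 0.
Proof.
move=> t0 dF cphi fphi; rewrite /oint t0.
have -> : F t - F 0 = prim phi t.
  apply/eqP; rewrite subr_eq addrC; apply/eqP.
  apply: (hder_eq F (fun s => F 0 + prim phi s) phi) => // [s s0|].
    rewrite -[phi s]add0r; apply: hderD; first exact: hder_cst.
    exact: hder_prim.
  by rewrite prim0 addr0.
move: t0; rewrite le_eqVlt => /predU1P[<-|t0].
  by rewrite set_itv1 Rintegral_set1 prim0.
have c := hcont_max _ cphi.
have ip u v : mu.-integrable `[u, v] (EFin \o (fun s : R => phi (Num.max 0 s))).
  apply: continuous_compact_integrable; first exact: segment_compact.
  exact: continuous_subspaceT.
have E : {in `]0, t]%classic, f =1 (fun s : R => phi (Num.max 0 s))}.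
  move=> s; rewrite inE/= in_itv/= => /andP[s0 _].
  by rewrite fphi// max_r// ltW.
have ifo : mu.-integrable `]0, t] (EFin \o f).
  apply: (@eq_integrable _ _ _ mu _ _
    (EFin \o (fun s : R => phi (Num.max 0 s)))) => //.
    by move=> s sI; rewrite /= E.
  apply: integrableS (ip 0 t) => //.
  by apply: subset_itvr; rewrite bnd_simp.
rewrite -Rintegral_itv_obnd_cbnd//.
under eq_Rintegral => s sI do rewrite E//.
by rewrite /prim Rintegral_itvB// bnd_simp ?ltW// lerN10.
Qed.

End OrientedIntegrals.

(** * The radial profiles of the connections in the variable s = t^2 *)

Section Profile.
Context {R : realType}.
Variables (A B : R -> R).
Hypotheses (sA : hsmooth A) (A_gt0 : forall t, 0 < t -> 0 < A t)
  (oddA : odd_at0 A) (dA0 : hderive A 0 = 2^-1)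
  (sB : hsmooth B) (B_gt0 : forall t, 0 <= t -> 0 < B t) (evenB : even_at0 B).

Let a (s : R) : R := mean 0 (hderive A) (Num.sqrt s).
Let b (s : R) : R := B (Num.sqrt s).

Local Lemma AE (t : R) : 0 <= t -> A t = t * a (t ^+ 2).
Proof.
move=> t0; rewrite /a sqrtr_sqr ger0_norm//.
by rewrite (hadamard A)// [A 0](oddA 0%N) add0r.
Qed.

Local Lemma a0 : a 0 = 2^-1.
Proof. by rewrite /a sqrtr0 /mean eqxx dA0 divr1. Qed.

Local Lemma a_gt0 s : 0 <= s -> 0 < a s.
Proof.
rewrite le_eqVlt => /predU1P[<-|s0]; first by rewrite a0 invr_gt0.
have q0 : 0 < Num.sqrt s by rewrite sqrtr_gt0.
have := AE (Num.sqrt s) (ltW q0); rewrite sqr_sqrtr ?ltW// => E.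
by have := A_gt0 _ q0; rewrite E pmulr_rgt0.
Qed.

(** [mean 0 (hderive A)] is A(t) / t, and its odd derivatives at 0 are multiples of even derivatives
    of [A], which vanish by oddness. *)
Local Lemma sa : hsmooth a.
Proof.
have sA' := hsmooth_hderive _ sA.
apply: (hsmooth_even_sqrt (mean 0 (hderive A))); first exact: hsmooth_mean.
move=> k; rewrite iter_hderive_mean// /mean eqxx -iterSr.
by rewrite -[_.+2]/(k.+1.*2) oddA mul0r.
Qed.

Local Lemma sb : hsmooth b.
Proof. exact: hsmooth_even_sqrt. Qed.

Local Lemma hsmooth_inva : hsmooth (fun s => (a s)^-1).
Proof. by apply: hsmoothV sa => s /a_gt0 /lt0r_neq0. Qed.

(** As [a 0 = 2^-1], Hadamard's lemma for 1 / a gives 1/A = 2/t + t m(t^2), while A/B^2 = t a/b^2.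
    Hence F = 2/t - A'/A + t r(t^2); the logarithmic derivative stays unexpanded because it
    integrates exactly. *)
Let m := mean 0 (hderive (fun s => (a s)^-1)).
Let r (s : R) : R := m s + -1 * (a s * ((b s)^-1 * (b s)^-1)).

Local Lemma sr : hsmooth r.
Proof.
apply: hsmoothD.
  by apply: hsmooth_mean; apply: hsmooth_hderive; exact: hsmooth_inva.
have sbV : hsmooth (fun s => (b s)^-1).
  by apply: hsmoothV sb => s s0; rewrite gt_eqF// B_gt0// sqrtr_ge0.
apply: hsmoothM; first exact: hsmooth_cst.
by apply: hsmoothM; [exact: sa|exact: hsmoothM].
Qed.

Local Lemma hder_primr (t : R) : 0 <= t -> hder (prim r) t (r t).
Proof. by apply: hder_prim => s; apply: hsmooth_hcont; exact: sr. Qed.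

Local Lemma sprimr : hsmooth (prim r).
Proof. by apply: (hsmooth_primitive _ r); [exact: hder_primr|exact: sr]. Qed.

(** The antiderivative of F read off from that decomposition; the factor [2^-1] compensates the
    derivative of t^2. *)
Let G (t : R) : R := ln t + ln t - ln (A t) + 2^-1 * prim r (t ^+ 2).

Local Lemma is_derive_G (t : R) : 0 < t -> is_derive t (1 : R) G (Ffun A B t).
Proof.
move=> t0; have tn0 := lt0r_neq0 t0; have t00 := ltW t0.
have An0 := lt0r_neq0 (A_gt0 _ t0).
have dA := hsmooth_hder A t sA t00.
have dln := is_derive1_ln t0.
apply: hder_is_derive => //.
have -> : Ffun A B t = t^-1 + t^-1 + -1 * ((A t)^-1 * hderive A t)
    + (0 * prim r (t ^+ 2) + 2^-1 * (r (t ^+ 2) * (2%:R * t ^+ 1))).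
  rewrite /Ffun /r /b sqrtr_sqr ger0_norm//.
  have Bn0 : B t != 0 by rewrite gt_eqF ?B_gt0.
  have := hadamard (fun s => (a s)^-1) (t ^+ 2) hsmooth_inva (sqr_ge0 t).
  rewrite a0 invrK -/m.
  have := AE t t00; move: (a_gt0 (t ^+ 2) (sqr_ge0 t)); set at2 := a _.
  move=> /lt0r_neq0 atn0 AtE mE.
  have -> : m (t ^+ 2) = (at2^-1 - 2) / t ^+ 2.
    by rewrite mE addrAC subrr add0r mulrC mulKf// expf_neq0.
  move: An0; rewrite AtE => An0; field.
  by rewrite Bn0 tn0 atn0.
apply: hderD; last first.
  apply: hderM => //; first exact: hder_cst.
  apply: (hder_compr (fun s => s ^+ 2)) => //; rewrite ?sqr_ge0//.
  - by move=> s _; exact: sqr_ge0.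
  - by apply: hder_primr; exact: sqr_ge0.
  - exact: hder_exprn.
have -> : (fun s => ln s + ln s - ln (A s))
    = (fun s => ln s + ln s + -1 * ln (A s)).
  by apply/funext => s; ring.
apply: hderD; first by apply: hderD; exact: is_derive_hder.
rewrite -[X in hder _ _ X]add0r -(mul0r (ln (A t))).
apply: hderM => //; first exact: hder_cst.
by apply: hder_comp => //; exact: is_derive1_ln (A_gt0 _ t0).
Qed.

Local Lemma Ffun_continuous (t : R) : 0 < t -> {for t, continuous (Ffun A B)}.
Proof.
move=> t0; have t00 := ltW t0.
have An0 := lt0r_neq0 (A_gt0 _ t0).
have Bn0 := lt0r_neq0 (B_gt0 _ t00).
have cA := hcont_continuous A t t0 (hsmooth_hcont A t sA t00).
have cA' := hcont_continuous _ t t0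
  (hsmooth_hcont _ t (hsmooth_hderive _ sA) t00).
have cB := hcont_continuous B t t0 (hsmooth_hcont B t sB t00).
have cAV : {for t, continuous (fun s => (A s)^-1)} by exact: continuousV.
apply: continuousB; first apply: continuousD => //.
  by apply: continuousN; exact: continuousM.
apply: continuousM => //; apply: continuousV; first by rewrite expf_neq0.
by apply: continuousM.
Qed.

(** Exponentiating the logarithms in [G] leaves t^2 / A, which is t / a. *)
Local Lemma expFE (t : R) : 0 < t -> expF A B t
  = expR (- G 2^-1) * expR (2^-1 * prim r (t ^+ 2)) * (t / a (t ^+ 2)).
Proof.
move=> t0; have tn0 := lt0r_neq0 t0.
have FTC : oint 2^-1 t (Ffun A B) = G t - G 2^-1.
  by apply: oint_FTC => // s; [exact: is_derive_G|exact: Ffun_continuous].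
rewrite /expF FTC expRD mulrC -mulrA; congr (_ * _).
rewrite /G 3!expRD expRN !lnK ?posrE ?A_gt0//.
rewrite mulrC; congr (_ * _).
have := a_gt0 (t ^+ 2) (sqr_ge0 t) => /lt0r_neq0 an0.
by rewrite (AE t (ltW t0)); field; rewrite tn0 an0.
Qed.

Let j (s : R) : R := expR (- G 2^-1) * expR (2^-1 * prim r s).
(** The density of [expF] after the substitution s = t^2, with [2^-1] coming from ds = 2 t dt. *)
Let e (s : R) : R := 2^-1 * (j s * (a s)^-1).

Local Lemma sj : hsmooth j.
Proof.
apply: hsmoothM; first exact: hsmooth_cst.
apply: hsmooth_expR; apply: hsmoothM; first exact: hsmooth_cst.
exact: sprimr.
Qed.

Local Lemma j_gt0 s : 0 < j s.
Proof. by rewrite mulr_gt0 ?expR_gt0. Qed.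

Local Lemma se : hsmooth e.
Proof.
apply: hsmoothM; first exact: hsmooth_cst.
by apply: hsmoothM; [exact: sj|exact: hsmooth_inva].
Qed.

Local Lemma e_gt0 s : 0 <= s -> 0 < e s.
Proof. by move=> s0; apply: mulr_gt0 => //; apply: mulr_gt0;
  rewrite ?invr_gt0 ?j_gt0 ?a_gt0. Qed.

Local Lemma hder_prime (t : R) : 0 <= t -> hder (prim e) t (e t).
Proof. by apply: hder_prim => s; apply: hsmooth_hcont; exact: se. Qed.

Local Lemma sprime : hsmooth (prim e).
Proof. by apply: (hsmooth_primitive _ e); [exact: hder_prime|exact: se]. Qed.

Let i := mean 0 (hderive (prim e)).

Local Lemma primeE (s : R) : 0 <= s -> prim e s = s * i s.
Proof.
by move=> s0; rewrite (hadamard _ s sprime s0) prim0 add0r.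
Qed.

(* In terms of [s = t ^+ 2], both [A * expF] and the integral of [expF] are s
   times smooth functions that agree at 0. *)
Lemma profile : exists i j : R -> R,
  [/\ hsmooth i /\ hsmooth j, j 0 = i 0, forall s, 0 <= s -> 0 < i s,
    forall t, 0 < t -> oint 0 t (expF A B) = t ^+ 2 * i (t ^+ 2) &
    forall t, 0 < t -> A t * expF A B t = t ^+ 2 * j (t ^+ 2)].
Proof.
exists i, j; split.
- split; last exact: sj.
  by apply: hsmooth_mean; apply: hsmooth_hderive; exact: sprime.
- rewrite /i /mean eqxx divr1 (hder_uniq _ _ (e 0))//; last exact: hder_prime.
  by rewrite /e a0; field.
- move=> s; rewrite le_eqVlt => /predU1P[<-|s0].
    rewrite /i /mean eqxx divr1 (hder_uniq _ _ (e 0)) ?e_gt0//.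
    exact: hder_prime.
  have [|c /andP[c0 _]] := hMVT _ _ _ s0 (fun t t0 => hder_prime t (ltW t0)).
    by apply: hder_hcont; exact: hder_prime.
  rewrite prim0 subr0 primeE ?ltW// mulrC => /(mulIf (lt0r_neq0 s0)) ->.
  by rewrite e_gt0// ltW.
- move=> t t0; rewrite -primeE ?sqr_ge0//.
  rewrite (oint0_FTC _ (fun t => prim e (t ^+ 2))
    (fun t => e (t ^+ 2) * (2%:R * t ^+ 1)))// ?ltW//.
  + by rewrite expr0n prim0 subr0.
  + move=> s s0; apply: (hder_compr (fun s => s ^+ 2)) => //.
    * exact: sqr_ge0.
    * by move=> u _; exact: sqr_ge0.
    * by apply: hder_prime; exact: sqr_ge0.
    * exact: hder_exprn.
  + move=> s s0; apply: hcontM.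
      apply: hder_hcont; apply: (hder_compr (fun s => s ^+ 2)) => //.
      * exact: sqr_ge0.
      * by move=> u _; exact: sqr_ge0.
      * by apply: hsmooth_hder; [exact: se|exact: sqr_ge0].
      * exact: hder_exprn.
    by apply: hcontM; [exact: hcont_cst|exact: hcontX].
  + move=> s s0; rewrite expFE// /e -/(j _).
    have := a_gt0 (s ^+ 2) (sqr_ge0 s) => /lt0r_neq0 an0.
    by field.
- move=> t t0; rewrite expFE// -/(j _) (AE t (ltW t0)).
  have := a_gt0 (t ^+ 2) (sqr_ge0 t) => /lt0r_neq0 an0.
  by field.
Qed.

End Profile.

(** * The connections along the fibres R^4 x {p} in quaternionic coordinates *)

Section Components.
Context {R : realType}.
Local Notation H := (quat R).
Implicit Types (f g : H -> R) (x v p : H).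

(** [L] is a bare function, so a directional derivative can be rewritten pointwise without building
    a linear map; differentiability is recorded separately. *)
Definition has_diff f x (L : H -> R) :=
  differentiable f x /\ forall v, 'D_v f x = L v.

Lemma has_diff_eq f x (L L' : H -> R) : has_diff f x L -> L =1 L' ->
  has_diff f x L'.
Proof. by move=> [df fL] LL'; split=> // v; rewrite fL LL'. Qed.

Lemma has_diff_is_derive f x (L : H -> R) v : has_diff f x L ->
  is_derive x v f (L v).
Proof. by move=> [df fL]; split; [exact: diff_derivable|exact: fL]. Qed.

Lemma has_diff_coord (l : 'I_4) x : has_diff (fun y => y 0 l) x (fun v => v 0 l).
Proof.
split=> [|v]; first exact: differentiable_coord.
have := derive_mx (@derivable_id R H x v).
by rewrite derive_id => /rowP/(_ l); rewrite !mxE.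
Qed.

Lemma has_diff_cst (c : R) x : has_diff (fun=> c) x (fun=> 0).
Proof. by split=> [|v]; [exact: differentiable_cst|rewrite derive_cst]. Qed.

Lemma has_diffD f g x (L L' : H -> R) : has_diff f x L -> has_diff g x L' ->
  has_diff (fun y => f y + g y) x (fun v => L v + L' v).
Proof.
move=> [df fL] [dg gL]; split=> [|v]; first exact: differentiableD.
by rewrite deriveD ?fL ?gL//; exact: diff_derivable.
Qed.

Lemma has_diffM f g x (L L' : H -> R) : has_diff f x L -> has_diff g x L' ->
  has_diff (fun y => f y * g y) x (fun v => L v * g x + f x * L' v).
Proof.
move=> [df fL] [dg gL]; split=> [|v]; first exact: differentiableM.
rewrite deriveM ?fL ?gL//; [|exact: diff_derivable..].
by rewrite /GRing.scale /=; ring.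
Qed.

Lemma has_diff_comp f x (L : H -> R) (h : R -> R) (d : R) : has_diff f x L ->
  is_derive (f x) (1 : R) h d ->
  has_diff (fun y => h (f y)) x (fun v => d * L v).
Proof.
move=> [df fL] [dh <-].
have dh' : differentiable h (f x) by exact/derivable1_diffP.
split=> [|v]; first exact: differentiable_comp.
rewrite deriveE; last exact: differentiable_comp.
rewrite diff_comp// deriv1E//= /GRing.scale /= -deriveE// fL derive1E mulrC.
by [].
Qed.

Definition qnorm2 x : R := x 0 0 ^+ 2 + x 0 1 ^+ 2 + x 0 2 ^+ 2 + x 0 3 ^+ 2.

Definition qdot x v : R :=
  x 0 0 * v 0 0 + x 0 1 * v 0 1 + x 0 2 * v 0 2 + x 0 3 * v 0 3.

Lemma qnormE x : qnorm x ^+ 2 = qnorm2 x.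
Proof. by rewrite sqr_qnorm. Qed.

Lemma qnorm2_ge0 x : 0 <= qnorm2 x.
Proof. by rewrite -qnormE sqr_ge0. Qed.

Lemma qnorm_sqrt x : qnorm x = Num.sqrt (qnorm2 x).
Proof. by rewrite -qnormE sqrtr_sqr ger0_norm ?qnorm_ge0. Qed.

Lemma qnorm_gt0 x : x != 0 -> 0 < qnorm x.
Proof.
move=> x0; rewrite lt_neqAle qnorm_ge0 andbT eq_sym.
apply: contraNneq x0 => nx; apply/eqP/quatP;
have := sqr_qnorm x; rewrite nx expr0n /= => /esym e;
rewrite /re /ci /cj /ck !mxE -/(re x) -/(ci x) -/(cj x) -/(ck x);
apply/eqP; rewrite -sqrf_eq0; apply/eqP; nra.
Qed.

Lemma has_diff_qnorm2 x : has_diff qnorm2 x (fun v => 2 * qdot x v).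
Proof.
have sq l : has_diff (fun y : H => y 0 l ^+ 2) x (fun v => 2 * (x 0 l * v 0 l)).
  apply: has_diff_eq; first exact: (has_diffM _ _ _ _ _
    (has_diff_coord l x) (has_diff_coord l x)).
  by move=> v; ring.
apply: has_diff_eq.
  by do 3![apply: has_diffD; last exact: sq]; exact: sq.
by move=> v; rewrite /qdot; ring.
Qed.

Lemma has_diff_qnorm x : x != 0 ->
  has_diff qnorm x (fun v => (2 * qnorm x)^-1 * (2 * qdot x v)).
Proof.
move=> x0; have -> : qnorm = (fun y => Num.sqrt (qnorm2 y)).
  by apply/funext => y; rewrite qnorm_sqrt.
apply: has_diff_comp; first exact: has_diff_qnorm2.
by apply: is_derive1_sqrt; rewrite -qnormE exprn_gt0// qnorm_gt0.
Qed.

Lemma has_diff_qnormV x : x != 0 ->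
  has_diff (fun y => (qnorm y)^-1) x (fun v => - qnorm x ^- 3 * qdot x v).
Proof.
move=> x0; have n0 := lt0r_neq0 (qnorm_gt0 x x0).
have dV : is_derive (qnorm x) (1 : R) (fun r => r^-1) (- qnorm x ^- 2 *: 1).
  exact: is_deriveV.
apply: has_diff_eq; first exact: has_diff_comp (has_diff_qnorm x x0) dV.
by move=> v /=; rewrite /GRing.scale /=; field.
Qed.

Lemma is_derive_rV (F : H -> H) x v (D : H) :
  (forall l, is_derive x v (fun y => F y 0 l) (D 0 l)) -> is_derive x v F D.
Proof.
move=> dF; have dd : derivable F x v.
  by apply/derivable_mxP => i l; rewrite (ord1 i); have [] := dF l.
split => //; rewrite derive_mx//; apply/rowP => l; rewrite mxE.
by have [_ ->] := dF l.
Qed.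

Definition radial x : H := (qnorm x)^-1 *: x.

Lemma S3_radial x : x != 0 -> S3 (radial x).
Proof.
move=> x0; have n0 := qnorm_gt0 x x0.
by rewrite /S3 /= /radial qnormZ gtr0_norm ?invr_gt0// mulVf ?gt_eqF.
Qed.

Lemma has_diff_radial x (l : 'I_4) : x != 0 ->
  has_diff (fun y => radial y 0 l) x
    (fun v => ((- qnorm x ^- 3 * qdot x v) *: x + (qnorm x)^-1 *: v) 0 l).
Proof.
move=> x0.
have -> : (fun y => radial y 0 l) = (fun y => (qnorm y)^-1 * y 0 l).
  by apply/funext => y; rewrite mxE.
apply: has_diff_eq.
  by apply: has_diffM; [exact: has_diff_qnormV|exact: has_diff_coord].
by move=> v; rewrite !mxE.
Qed.

Lemma is_derive_radial x v : x != 0 ->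
  is_derive x v radial
    ((- qnorm x ^- 3 * qdot x v) *: x + (qnorm x)^-1 *: v).
Proof.
move=> x0; apply: is_derive_rV => l.
exact: has_diff_is_derive _ _ _ v (has_diff_radial x l x0).
Qed.

Lemma qmul_coord p (l : 'I_4) : exists c : 'I_4 -> R, forall q : H,
  qmul p q 0 l = c 0 * q 0 0 + c 1 * q 0 1 + c 2 * q 0 2 + c 3 * q 0 3.
Proof.
case: l => -[|[|[|[|//]]]] ?.
- exists (tnth [tuple re p; - ci p; - cj p; - ck p]) => q.
  by rewrite mxE /= !(tnth_nth 0) /= /re /ci /cj /ck; ring.
- exists (tnth [tuple ci p; re p; - ck p; cj p]) => q.
  by rewrite mxE /= !(tnth_nth 0) /= /re /ci /cj /ck; ring.
- exists (tnth [tuple cj p; ck p; re p; - ci p]) => q.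
  by rewrite mxE /= !(tnth_nth 0) /= /re /ci /cj /ck; ring.
- exists (tnth [tuple ck p; - cj p; ci p; re p]) => q.
  by rewrite mxE /= !(tnth_nth 0) /= /re /ci /cj /ck; ring.
Qed.

Lemma has_diff_qmul (F D : H -> H) p x :
  (forall l, has_diff (fun y => F y 0 l) x (fun v => D v 0 l)) ->
  forall l, has_diff (fun y => qmul p (F y) 0 l) x (fun v => qmul p (D v) 0 l).
Proof.
move=> dF l; have [c cE] := qmul_coord p l.
have -> : (fun y => qmul p (F y) 0 l) = (fun y => c 0 * F y 0 0 + c 1 * F y 0 1
  + c 2 * F y 0 2 + c 3 * F y 0 3) by apply/funext => y; exact: cE.
have cF k : has_diff (fun y => c k * F y 0 k) x (fun v => c k * D v 0 k).
  apply: has_diff_eq.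
    by apply: has_diffM; [exact: has_diff_cst|exact: dF].
  by move=> v; rewrite mul0r add0r.
apply: has_diff_eq; last by move=> v; rewrite cE.
by do 3![apply: has_diffD; last exact: cF]; exact: cF.
Qed.

Lemma quatDE p q :
  (re (p + q) = re p + re q) * (ci (p + q) = ci p + ci q) *
  (cj (p + q) = cj p + cj q) * (ck (p + q) = ck p + ck q).
Proof. by rewrite /re /ci /cj /ck !mxE. Qed.

Definition im p : H := mkq 0 (ci p) (cj p) (ck p).

(** The derivative of x / |x| is v / |x| minus a multiple of x. Left translation turns that multiple
    into a real number, which cancels exactly the real part of conj(x) v. *)
Lemma radial_left_translate x v : x != 0 ->
  qmul (qconj (radial x)) ('D_v radial x)
    = (qnorm x ^- 2) *: im (qmul (qconj x) v).
Proof.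
move=> x0; have [_ ->] := is_derive_radial x v x0.
have := sqr_qnorm x; have := qnorm_gt0 x x0.
rewrite /radial /qdot -!/(re _) -!/(ci _) -!/(cj _) -!/(ck _).
move: (qnorm x) => r r0 rE; have rn0 := lt0r_neq0 r0.
set d := _ + _ + _ + _; set k := - _ * d.
rewrite /im; apply: quatP; rewrite !(quatZE, mkqE, quatDE, mulr0).
- transitivity (k * r^-1 * r ^+ 2 + r^-1 * r^-1 * d); last by rewrite /k; field.
  by rewrite rE /d; ring.
- by rewrite expr2 invfM; ring.
- by rewrite expr2 invfM; ring.
- by rewrite expr2 invfM; ring.
Qed.

(** A directional derivative depends only on the restriction to a line; along a fibre, [chart] can
    thus be differentiated as a map of one quaternion. *)
Lemma derive_line (U V W : normedModType R) (f : U -> W) (g : V -> W)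
    (z u : U) (x v : V) :
  (forall h : R, f (h *: u + z) = g (h *: v + x)) -> 'D_u f z = 'D_v g x.
Proof.
move=> fg; rewrite /derive.
have fgz : f z = g x by have := fg 0; rewrite !scale0r !add0r.
have -> : (fun h : R => h^-1 *: ((f \o shift z) (h *: u) - f z)) =
  (fun h : R => h^-1 *: ((g \o shift x) (h *: v) - g x)).
  by apply/funext => h /=; rewrite fg fgz.
by [].
Qed.

Lemma is_derive_pair (V W W' : normedModType R) (f : V -> W) (g : V -> W')
    (x v : V) (df : W) (dg : W') : is_derive x v f df -> is_derive x v g dg ->
  is_derive x v (fun y => (f y, g y)) (df, dg).
Proof.
move=> [/cvg_ex[/= l fl] <-] [/cvg_ex[/= k gk] <-].
have E : (fun h : R => h^-1 *: (((fun y => (f y, g y)) \o shift x) (h *: v)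
   - (f x, g x))) @ 0^' --> (l, k) by exact: (cvg_pair fl gk).
split; first by apply/cvg_ex; exists (l, k).
rewrite /derive (cvg_lim _ E)//; congr (_, _); apply/esym; exact: cvg_lim.
Qed.

(* The fibre derivative of the chart: the SU(2)^2-component of the velocity is
   the left translate of the diagonal vector (u, u). *)
Lemma derive_chart x v p : x != 0 -> S3 p ->
  let u := (qnorm x ^- 2) *: im (qmul (qconj x) v) in
  pairmul (pairconj (chart (x, p)).2) ('D_(v, 0) chart (x, p)).2 = (u, u).
Proof.
move=> x0 p1 u.
have -> : 'D_(v, 0) chart (x, p) = 'D_v (fun y => chart (y, p)) x.
  apply: derive_line => h; congr chart.
  by rewrite /+%R /= /add_pair /= scaler0 add0r.
have dr := is_derive_radial x v x0.
have dq : is_derive x v (fun y => qmul (qconj p) (radial y))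
    (qmul (qconj p) ('D_v radial x)).
  have [_ ->] := dr.
  apply: (is_derive_rV (fun y => qmul (qconj p) (radial y)) x v) => l.
  exact: (has_diff_is_derive _ _ _ v (has_diff_qmul radial
    (fun v => (- qnorm x ^- 3 * qdot x v) *: x + (qnorm x)^-1 *: v)
    (qconj p) x (fun l => has_diff_radial x l x0) l)).
have dn := has_diff_is_derive _ _ _ v (has_diff_qnorm x x0).
have dr' : is_derive x v radial ('D_v radial x) by split => //; case: dr.
have [_ ->] := is_derive_pair _ _ _ _ _ _ _ _ _ dn
  (is_derive_pair _ _ _ _ _ _ _ _ _ dr' dq).
rewrite /pairmul /pairconj /=; congr (_, _); first exact: radial_left_translate.
rewrite qconjM qconjK -qmulA S3_qmul_qconj//; exact: radial_left_translate.
Qed.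

Lemma imP p : su2 (im p).
Proof. by rewrite /su2 /= /im mkqE. Qed.

Lemma su2Z (c : R) p : su2 p -> su2 (c *: p).
Proof. by rewrite /su2 /= quatZE => ->; rewrite mulr0. Qed.

Variable T : 3.-tuple H.
Hypothesis T_std : standard_basis T.

Lemma su2_span u : su2 u -> \sum_(i < 3) coord T i u *: tnth T i = u.
Proof.
move=> u0; have [T0 fT _ _ _] := T_std.
pose E : 3.-tuple H := [tuple mkq 0 1 0 0; mkq 0 0 1 0; mkq 0 0 0 1].
have EP p : su2 p -> p \in <<E>>%VS.
  move=> p0.
  have -> : p = ci p *: E`_0 + cj p *: E`_1 + ck p *: E`_2.
    apply: quatP; rewrite !(quatDE, quatZE, mkqE) /= ?(p0 : re p = 0); ring.
  by rewrite !rpredD// rpredZ// memv_span// mem_nth.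
(* Freeness gives [T] a span of dimension 3, and [E] spans at most 3 dimensions, so one inclusion of
   spans suffices. *)
have dE : (\dim <<T>> >= \dim <<E>>)%N.
  by rewrite (eqnP fT) size_tuple (leq_trans (dim_span _))// size_tuple.
have TE : <<T>>%VS = <<E>>%VS.
  apply/eqP; rewrite eqEdim dE andbT; apply/span_subvP => v /tnthP[i ->].
  exact: EP.
under eq_bigr do rewrite (tnth_nth 0).
by rewrite -coord_span// TE EP.
Qed.

(** The diagonal of su(2) + su(2) is spanned by the vectors T_i^+ alone, with the coefficients of
    [u] in [T]. *)
Lemma coord_Tpm_diag (i : 'I_3) u : su2 u ->
  coord (Tpm T) (lshift 3 i) (u, u) = coord T i u.
Proof.
move=> u0; have [_ fT _ _ _] := T_std.
have fTT : free (Tpm T) by exact: free_Tpm.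
have -> : (u, u) = \sum_(k < 3) coord T k u *: (Tpm T)`_(lshift 3 k).
  have E : \sum_(k < 3) coord T k u *: (Tpm T)`_(lshift 3 k)
      = \sum_(k < 3) coord T k u *: (tnth T k, tnth T k).
    by apply: eq_bigr => k _; rewrite -tnth_nth tnth_Tpm_plus.
  rewrite E; rewrite -[LHS]/(_, _) -{1}(su2_span u u0) -{2}(su2_span u u0).
  rewrite [RHS]surjective_pairing fst_sum snd_sum.
  by congr (_, _); apply: eq_bigr.
have cf (k l : 'I_(3 + 3)) (c : R) :
    coord (Tpm T) k (c *: (Tpm T)`_l) = c * (l == k)%:R.
  by rewrite linearZ /= coord_free.
rewrite linear_sum.
rewrite (eq_bigr (fun k => coord T k u * (lshift 3 k == lshift 3 i)%:R)).
  rewrite (bigD1 i)//= big1 ?addr0 => [|k ki]; first by rewrite eqxx mulr1.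
  by rewrite eq_lshift (negPf ki) mulr0.
by move=> k _; exact: cf.
Qed.

Lemma conn_plusE (f : R -> R) (y w : R * (H * H)) u : su2 u ->
  pairmul (pairconj y.2) w.2 = (u, u) -> conn_plus T f y w = f y.1 *: u.
Proof.
move=> u0 yw; rewrite /conn_plus; congr (_ *: _).
rewrite -[RHS](su2_span u u0); apply: eq_bigr => i _.
by rewrite /eta_plus /eta yw coord_Tpm_diag.
Qed.

Lemma on_M_conn_plusE (f : R -> R) x v p : S3 p -> x != 0 ->
  on_M (conn_plus T f) (x, p) (v, 0)
    = (f (qnorm x) / qnorm x ^+ 2) *: im (qmul (qconj x) v).
Proof.
move=> p1 x0; rewrite /on_M /= (negPf x0) /pullback.
rewrite (conn_plusE _ _ _ ((qnorm x ^- 2) *: im (qmul (qconj x) v))).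
- by rewrite scalerA.
- by apply: su2Z; exact: imP.
- exact: derive_chart.
Qed.

Lemma derive_s_map (delta : R) p x v :
  'D_v (s_map delta p) x = (delta *: v, 0).
Proof.
have -> : s_map delta p = (fun y : H => (delta *: y, p)) by [].
have d1 : is_derive x v (fun y : H => delta *: y) (delta *: v).
  exact: (is_deriveZ delta (is_derive_id x v)).
by have [_ ->] := is_derive_pair _ _ _ _ _ _ _ _ _ d1 (is_derive_cst p x v).
Qed.

(** Replacing (x, v) by (delta x, delta v) multiplies Im(conj(x) v) and |x|^2 by the same factor, so
    the dilation affects only the argument of [f]. *)
Lemma pullback_conn_plusE (f : R -> R) (delta : R) p x v : S3 p -> 0 < delta ->
  x != 0 -> pullback (s_map delta p) (on_M (conn_plus T f)) x v
    = (f (delta * qnorm x) / qnorm x ^+ 2) *: im (qmul (qconj x) v).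
Proof.
move=> p1 d0 x0; rewrite /pullback derive_s_map on_M_conn_plusE//; last first.
  by rewrite scaler_eq0 negb_or x0 gt_eqF.
rewrite qnormZ gtr0_norm//.
have -> : im (qmul (qconj (delta *: x)) (delta *: v))
    = delta ^+ 2 *: im (qmul (qconj x) v).
  by apply: quatP; rewrite !(quatZE, mkqE); ring.
rewrite scalerA; congr (_ *: _).
by field; rewrite !gt_eqF// qnorm_gt0.
Qed.

(** The factor |x|^2 in the numerator cancels the pole of the coframe; the resulting formula also
    holds at the origin, where both sides vanish. *)
Lemma theta_ASD_E (lambda : R) x v : 0 < lambda ->
  theta_ASD T lambda x v
    = (lambda / (1 + lambda * qnorm2 x)) *: im (qmul (qconj x) v).
Proof.
move=> l0; rewrite /theta_ASD; have [->|x0] := eqVneq x 0.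
  rewrite (_ : im _ = 0) ?scaler0//.
  by apply: quatP; rewrite !mkqE /re /ci /cj /ck !mxE; ring.
have n0 := qnorm_gt0 x x0.
have E i : eta_S3 T i x v = coord T i ((qnorm x ^- 2) *: im (qmul (qconj x) v)).
  by rewrite -radial_left_translate.
under eq_bigr do rewrite E.
rewrite su2_span; last by apply: su2Z; exact: imP.
rewrite scalerA -qnormE; congr (_ *: _).
have d0 : 1 + lambda * qnorm x ^+ 2 != 0.
  by rewrite lt0r_neq0// ltr_wpDr// mulr_ge0 ?sqr_ge0 ?ltW.
by field; rewrite d0 lt0r_neq0.
Qed.

End Components.

(** * A differential algebra of expressions and its limit at scale 0 *)

Section RadialExpressions.
Context {R : realType}.
Local Notation H := (quat R).
Variables (lambda : R) (i : R -> R).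
Hypotheses (lambda_gt0 : 0 < lambda) (si : hsmooth i)
  (i_gt0 : forall s, 0 <= s -> 0 < i s).

(* Functions of x that also depend on the squared scale eps.  They form an
   algebra closed under partial derivatives in x, on which the limit eps -> 0 is
   uniform over the unit ball; this gives convergence of all derivatives. *)
Inductive expr : Type :=
| Cst of R
| Crd of 'I_4
| Eps
| Rad (h : R -> R) of hsmooth h
| Quo
| Add of expr & expr
| Mul of expr & expr.

Fixpoint den (eps : R) (E : expr) (x : H) : R :=
  match E with
  | Cst c => c
  | Crd l => x 0 l
  | Eps => eps
  | Rad h _ => h (eps * qnorm2 x)
  | Quo => (1 + lambda * qnorm2 x * i (eps * qnorm2 x))^-1
  | Add E1 E2 => den eps E1 x + den eps E2 x
  | Mul E1 E2 => den eps E1 x * den eps E2 x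
  end.

Definition Qnorm2 : expr :=
  Add (Add (Add (Mul (Crd 0) (Crd 0)) (Mul (Crd 1) (Crd 1)))
    (Mul (Crd 2) (Crd 2))) (Mul (Crd 3) (Crd 3)).

Definition dRad (k : 'I_4) h (sh : hsmooth h) : expr :=
  Mul (Rad _ (hsmooth_hderive _ sh)) (Mul Eps (Mul (Cst 2) (Crd k))).

(** [Rad] carries a smoothness proof so that the derived profile is again admissible. The derivative
    of [Quo] is [Quo] squared times an expression free of inverses, so only one denominator ever has
    to be shown positive. *)
Fixpoint partial (k : 'I_4) (E : expr) : expr :=
  match E with
  | Cst _ => Cst 0
  | Crd l => Cst (e_ k 0 l)
  | Eps => Cst 0
  | Rad h sh => dRad k h sh
  | Quo => Mul (Mul (Cst (-1)) (Mul Quo Quo))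
      (Add (Mul (Mul (Cst lambda) (Mul (Cst 2) (Crd k))) (Rad _ si))
           (Mul (Mul (Cst lambda) Qnorm2) (dRad k _ si)))
  | Add E1 E2 => Add (partial k E1) (partial k E2)
  | Mul E1 E2 => Add (Mul (partial k E1) E2) (Mul E1 (partial k E2))
  end.

Lemma qdot_e (x : H) (k : 'I_4) : qdot x (e_ k) = x 0 k.
Proof.
rewrite /qdot /e_ !mxE !eqxx /=.
have E (j l : 'I_4) : (l == j) = (val l == val j :> nat) by [].
rewrite !E; case: k => -[|[|[|[|//]]]] p /=; rewrite ?mulr0 ?mulr1 ?addr0 ?add0r;
  by congr (x 0 _); apply: val_inj.
Qed.

Lemma quo_gt0 eps (x : H) : 0 <= eps ->
  0 < 1 + lambda * qnorm2 x * i (eps * qnorm2 x).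
Proof.
move=> e0; have := qnorm2_ge0 x => n0.
by rewrite ltr_wpDr// !mulr_ge0 ?(ltW lambda_gt0)// ltW// i_gt0// mulr_ge0.
Qed.

Lemma quo_itv eps (x : H) : 0 <= eps ->
  0 <= (1 + lambda * qnorm2 x * i (eps * qnorm2 x))^-1 <= 1.
Proof.
move=> e0; have q0 := quo_gt0 eps x e0.
rewrite invr_ge0 (ltW q0) invf_le1// lerDl !mulr_ge0 ?qnorm2_ge0 ?ltW//.
by rewrite i_gt0// mulr_ge0 ?qnorm2_ge0.
Qed.

(** At the origin the argument reaches the endpoint of the half-line. Since it never becomes
    negative, [h] may be replaced by an extension that is differentiable in the ordinary sense. *)
Lemma hsmooth_comp_qnorm2 eps h (x : H) : hsmooth h -> 0 <= eps ->
  has_diff (fun y => h (eps * qnorm2 y)) x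
    (fun v => hderive h (eps * qnorm2 x) * (eps * (2 * qdot x v))).
Proof.
move=> sh e0.
have nn y : 0 <= eps * qnorm2 y :> R by rewrite mulr_ge0 ?qnorm2_ge0.
have [g gh dg] := hsmooth_hder h _ sh (nn x).
have -> : (fun y => h (eps * qnorm2 y)) = (fun y => g (eps * qnorm2 y)).
  by apply/funext => y; rewrite gh.
apply: has_diff_comp dg; apply: has_diff_eq.
  by apply: has_diffM; [exact: has_diff_cst|exact: has_diff_qnorm2].
by move=> v; rewrite mul0r add0r.
Qed.

Lemma has_diff_den eps E (x : H) : 0 <= eps ->
  exists2 L, has_diff (den eps E) x L & forall k, L (e_ k) = den eps (partial k E) x.
Proof.
move=> e0; elim: E => [c|l||h sh||E1 [L1 d1 L1E] E2 [L2 d2 L2E]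
    |E1 [L1 d1 L1E] E2 [L2 d2 L2E]] /=.
- by exists (fun=> 0) => //; exact: has_diff_cst.
- by exists (fun v => v 0 l) => //; exact: has_diff_coord.
- by exists (fun=> 0) => //; exact: has_diff_cst.
- exists (fun v => hderive h (eps * qnorm2 x) * (eps * (2 * qdot x v))).
    exact: hsmooth_comp_qnorm2.
  by move=> k; rewrite qdot_e.
- have d := has_diffD _ _ _ _ _ (has_diff_cst 1 x)
    (has_diffM _ _ _ _ _ (has_diffM _ _ _ _ _ (has_diff_cst lambda x)
       (has_diff_qnorm2 x)) (hsmooth_comp_qnorm2 eps i x si e0)).
  have n0 := lt0r_neq0 (quo_gt0 eps x e0).
  have dV : is_derive (1 + lambda * qnorm2 x * i (eps * qnorm2 x)) (1 : R)
      (fun r => r^-1) (- (1 + lambda * qnorm2 x * i (eps * qnorm2 x)) ^- 2 *: 1).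
    exact: is_deriveV.
  have := has_diff_comp _ _ _ _ _ d dV.
  set L := (X in has_diff _ _ X) => dL; exists L => // k.
  rewrite /L qdot_e /GRing.scale /= -/(qnorm2 x) expr2 invfM.
  by rewrite /qnorm2; ring.
- exists (fun v => L1 v + L2 v); first exact: has_diffD.
  by move=> k; rewrite L1E L2E.
- exists (fun v => L1 v * den eps E2 x + den eps E1 x * L2 v).
    exact: has_diffM.
  by move=> k; rewrite L1E L2E.
Qed.

(** A bound on the limit alone suffices for products: the error terms are themselves bounded near
    the limit. *)
Lemma den_bounded E : exists C : R, forall x : H, qnorm2 x < 1 ->
  `|den 0 E x| <= C.
Proof.
elim: E => [c|l||h sh||E1 [C1 b1] E2 [C2 b2]|E1 [C1 b1] E2 [C2 b2]] /=.
- by exists `|c|.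
- exists 1 => x x1; rewrite -(ler_pXn2r (_ : 0 < 2)%N) ?nnegrE// expr1n.
  rewrite real_normK ?num_real// (le_trans _ (ltW x1))// /qnorm2.
  have sq (m : 'I_4) : 0 <= x 0 m ^+ 2 by exact: sqr_ge0.
  have := sq 0; have := sq 1; have := sq 2; have := sq 3.
  by case: l => -[|[|[|[|//]]]] p; (set y := x 0 (Ordinal p));
    [have -> : x 0 0 = y|have -> : x 0 1 = y|have -> : x 0 2 = y
    |have -> : x 0 3 = y]; try (by congr (x 0 _); apply: val_inj); lra.
- by exists 0 => x _; rewrite normr0.
- by exists `|h 0| => x _; rewrite mul0r.
- exists 1 => x _; have /andP[q0 q1] := quo_itv 0 x (lexx 0).
  by rewrite ger0_norm.
- exists (C1 + C2) => x x1.
  by rewrite (le_trans (ler_normD _ _))// lerD ?b1 ?b2.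
- exists (C1 * C2) => x x1.
  by rewrite normrM ler_pM ?b1 ?b2.
Qed.

(** On the unit ball the argument lies between 0 and [eps], so continuity at the single point 0 is
    already uniform in [x]. *)
Lemma hcont_uniform h (e : R) : hcont h 0 -> 0 < e ->
  \forall eps \near (0 : R)^'+, forall x : H, qnorm2 x < 1 ->
    `|h (eps * qnorm2 x) - h 0| < e.
Proof.
move=> /hcont0P/cvgrPdist_lt/(_ e) + e0 => /(_ e0).
rewrite /at_right !near_withinE => -[r /= r0 rH].
near=> eps => eps0 x x1.
have := qnorm2_ge0 x; rewrite le_eqVlt => /predU1P[<-|n0].
  by rewrite mulr0 subrr normr0.
rewrite distrC; apply: rH; rewrite /= ?mulr_gt0//.
rewrite sub0r normrN gtr0_norm ?mulr_gt0//.
rewrite (@le_lt_trans _ _ eps)// ?ler_piMr ?(ltW eps0) ?(ltW x1)//.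
by near: eps; exact: lt_nbhsl.
Unshelve. all: by end_near. Qed.

Lemma den_uniform E (e : R) : 0 < e ->
  \forall eps \near (0 : R)^'+, forall x : H, qnorm2 x < 1 ->
    `|den eps E x - den 0 E x| < e.
Proof.
elim: E e => [c|l||h sh||E1 u1 E2 u2|E1 u1 E2 u2] e e0 /=.
- by near=> eps => x _; rewrite subrr normr0.
- by near=> eps => x _; rewrite subrr normr0.
- near=> eps => x _; rewrite subr0 gtr0_norm; near: eps.
    exact: nbhs_right_lt.
  exact: nbhs_right_gt.
- near=> eps => x x1; rewrite mul0r; move: x x1.
  by near: eps; apply: hcont_uniform => //; exact: hsmooth_hcont.
- near=> eps => x x1; rewrite mul0r.
  have eps0 : 0 <= eps by apply/ltW; near: eps; exact: nbhs_right_gt.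
  have p := quo_gt0 eps x eps0; have := quo_gt0 0 x (lexx _).
  rewrite mul0r => p0; have := qnorm2_ge0 x => n0.
  (* Both inverses lie in [0, 1] and [qnorm2 x < 1], so their difference is at most [lambda] times
     this one. *)
  have D : `|i (eps * qnorm2 x) - i 0| < e / lambda.
    move: x x1 {p p0 n0}; near: eps; apply: hcont_uniform.
      exact: hsmooth_hcont.
    by rewrite divr_gt0.
  have -> : (1 + lambda * qnorm2 x * i (eps * qnorm2 x))^-1
      - (1 + lambda * qnorm2 x * i 0)^-1
    = (1 + lambda * qnorm2 x * i (eps * qnorm2 x))^-1
      * (1 + lambda * qnorm2 x * i 0)^-1
      * (lambda * qnorm2 x * (i 0 - i (eps * qnorm2 x))).
    by field; rewrite !lt0r_neq0.
  have /andP[a0 a1] := quo_itv eps x eps0.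
  have := quo_itv 0 x (lexx 0); rewrite mul0r => /andP[b0 b1].
  rewrite distrC ltr_pdivlMr// mulrC in D; apply: le_lt_trans D.
  rewrite normrM ger0_norm ?mulr_ge0//.
  rewrite (le_trans (ler_piMl _ _))// ?mulr_ile1//.
  rewrite !normrM (ger0_norm n0) (gtr0_norm lambda_gt0).
  by rewrite ler_wpM2r// ler_piMr ?(ltW lambda_gt0)// ltW.
- have e20 : 0 < e / 2 by rewrite divr_gt0.
  near=> eps => x x1; rewrite opprD addrACA (splitr e).
  rewrite (le_lt_trans (ler_normD _ _))// ltrD//; move: x x1; near: eps.
    exact: u1.
  exact: u2.
- have [C1 b1] := den_bounded E1; have [C2 b2] := den_bounded E2.
  have C10 : 0 <= C1 by rewrite (le_trans _ (b1 0 _))// /qnorm2 !mxE expr0n !addr0.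
  have C20 : 0 <= C2 by rewrite (le_trans _ (b2 0 _))// /qnorm2 !mxE expr0n !addr0.
  (* With [d <= 1] the three error terms of the product are at most [d], [d * C2] and [C1 * d], in
     total [d * c]; dividing by [c + 1] makes the final bound strict. *)
  pose c := C1 + C2 + 1; have c0 : 0 < c by rewrite ltr_wpDl// addr_ge0.
  pose d := Num.min 1 (e / (c + 1)).
  have d0 : 0 < d by rewrite lt_min ltr01 divr_gt0// addr_gt0.
  near=> eps => x x1.
  have v1 : `|den eps E1 x - den 0 E1 x| < d by move: x x1; near: eps; exact: u1.
  have v2 : `|den eps E2 x - den 0 E2 x| < d.
    by move: x x1 {v1}; near: eps; exact: u2.
  have -> : den eps E1 x * den eps E2 x - den 0 E1 x * den 0 E2 x =
     (den eps E1 x - den 0 E1 x) * (den eps E2 x - den 0 E2 x)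
     + (den eps E1 x - den 0 E1 x) * den 0 E2 x
     + den 0 E1 x * (den eps E2 x - den 0 E2 x) by ring.
  apply: (@le_lt_trans _ _ (d * 1 + d * C2 + C1 * d)).
    rewrite (le_trans (ler_normD _ _))// lerD//.
      rewrite (le_trans (ler_normD _ _))// lerD// normrM; apply: ler_pM => //.
      - exact: ltW.
      - by rewrite (le_trans (ltW v2))// ge_min lexx.
      - exact: ltW.
      - exact: b2.
    by rewrite normrM; apply: ler_pM => //; [exact: b1|exact: ltW].
  have -> : d * 1 + d * C2 + C1 * d = d * c by rewrite /c; ring.
  rewrite (@le_lt_trans _ _ (e / (c + 1) * c))//.
    by rewrite ler_wpM2r ?(ltW c0)// ge_min lexx orbT.
  by rewrite -mulrA gtr_pMr// mulrC ltr_pdivrMr ?mul1r ?ltrDl// addr_gt0.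
Unshelve. all: by end_near. Qed.

Definition vden eps (F : 'I_4 -> expr) (x : H) : H := \row_l den eps (F l) x.

Lemma vden_differentiable eps F (x : H) : 0 <= eps ->
  differentiable (vden eps F) x.
Proof.
move=> e0.
have -> : vden eps F = \sum_(l < 4) (fun y => den eps (F l) y *: delta_mx 0 l).
  apply/funext => y; rewrite fct_sumE [LHS]row_sum_delta.
  by apply: eq_bigr => l _; rewrite mxE.
apply: differentiable_sum => l; apply: differentiableZl.
by have [L [dL _] _] := has_diff_den eps (F l) x e0.
Qed.

Lemma derive_vden eps F k (x : H) : 0 <= eps ->
  'D_(e_ k) (vden eps F) x = vden eps (partial k \o F) x.
Proof.
move=> e0; suff d : is_derive x (e_ k) (vden eps F) (vden eps (partial k \o F) x).
  by case: d.
apply: is_derive_rV => l; rewrite mxE /=.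
have [L dL <-] := has_diff_den eps (F l) x e0.
have -> : (fun y => vden eps F y 0 l) = den eps (F l).
  by apply/funext => y; rewrite mxE.
exact: has_diff_is_derive.
Qed.

Lemma iter_partial_vden eps js F : 0 <= eps ->
  iter_partial js (vden eps F)
    = vden eps (fun l => foldr partial (F l) js).
Proof.
move=> e0; elim: js => [//|k js IH]; apply/funext => x.
by rewrite /= -/(iter_partial js _) IH derive_vden.
Qed.

Lemma smooth_on_vden U eps F : 0 <= eps -> smooth_on U (vden eps F).
Proof.
by move=> e0 js x _; rewrite iter_partial_vden//; exact: vden_differentiable.
Qed.

Lemma vden_uniform F (e : R) : 0 < e ->
  \forall eps \near (0 : R)^'+, forall x : H, qnorm2 x < 1 ->
    `|vden 0 F x - vden eps F x| < e.
Proof.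
move=> e0.
have : \forall eps \near (0 : R)^'+, forall l : 'I_4, forall x : H,
    qnorm2 x < 1 -> `|den eps (F l) x - den 0 (F l) x| < e.
  by apply: filter_forall => l; exact: den_uniform.
apply: filterS => eps He x x1; rewrite distrC.
rewrite [ltLHS]/Num.Def.normr/= mx_normrE bigmax_lt//= => -[a l] _.
by rewrite !mxE; exact: He.
Qed.

Lemma cvg_Coo_vden (eps : R -> R) (alpha : R -> form1 H H) (beta : form1 H H)
    (F : 'I_4 -> 'I_4 -> expr) :
  eps s @[s --> +oo] --> (0 : R)^'+ ->
  (\forall s \near +oo, forall k, (fun x => alpha s x (e_ k)) = vden (eps s) (F k)) ->
  (forall k, (fun x => beta x (e_ k)) = vden 0 (F k)) ->
  cvg_Coo (ball4 1) alpha (pinfty_nbhs R) beta.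
Proof.
move=> ceps aE bE k.
have eps0 : \forall s \near +oo, 0 <= eps s.
  have /ceps : \forall e \near (0 : R)^'+, 0 <= e.
    by near=> e; apply/ltW; near: e; exact: nbhs_right_gt.
  exact.
split.
- near=> s.
  have /(_ k) -> : forall k, (fun x => alpha s x (e_ k)) = vden (eps s) (F k).
    by near: s.
  by apply: smooth_on_vden; near: s.
- by rewrite bE; exact: smooth_on_vden.
move=> js P /uniform_nbhs[E [entE EP]].
move: entE; rewrite -entourage_ballE => -[e /= e0 eE].
have /ceps := vden_uniform (fun l => foldr partial (F k l) js) e e0.
rewrite /fmap /= => uE.
near=> s; apply: EP => x; rewrite /ball4 /= => x1; apply: eE => /=.
have /(_ k) -> : forall k, (fun x => alpha s x (e_ k)) = vden (eps s) (F k).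
  by near: s.
rewrite bE !iter_partial_vden//; last by near: s.
rewrite -ball_normE /=.
have : qnorm2 x < 1 by rewrite -qnormE expr_lt1// qnorm_ge0.
by move: x {x1}; near: s.
Unshelve. all: by end_near. Qed.

End RadialExpressions.

(** * Bubbling at the singular orbit and convergence away from it *)

Section Bubbling.
Context {R : realType}.
Local Notation H := (quat R).
Variables (A B : R -> R) (T : 3.-tuple H) (i j : R -> R).
Hypotheses (T_std : standard_basis T) (si : hsmooth i) (sj : hsmooth j)
  (ji0 : j 0 = i 0) (i_gt0 : forall s, 0 <= s -> 0 < i s)
  (intE : forall t, 0 < t -> oint 0 t (expF A B) = t ^+ 2 * i (t ^+ 2))
  (AexpE : forall t, 0 < t -> A t * expF A B t = t ^+ 2 * j (t ^+ 2)).

Lemma im_coord (v : H) (l : 'I_4) : exists c : 'I_4 -> R, forall x : H,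
  im (qmul (qconj x) v) 0 l = c 0 * x 0 0 + c 1 * x 0 1 + c 2 * x 0 2 + c 3 * x 0 3.
Proof.
case: l => -[|[|[|[|//]]]] ?.
- by exists (fun=> 0) => x; rewrite mxE /=; ring.
- exists (tnth [tuple ci v; - re v; - ck v; cj v]) => x.
  by rewrite mxE /= !mkqE !(tnth_nth 0) /= /re /ci /cj /ck; ring.
- exists (tnth [tuple cj v; ck v; - re v; - ci v]) => x.
  by rewrite mxE /= !mkqE !(tnth_nth 0) /= /re /ci /cj /ck; ring.
- exists (tnth [tuple ck v; - cj v; ci v; - re v]) => x.
  by rewrite mxE /= !mkqE !(tnth_nth 0) /= /re /ci /cj /ck; ring.
Qed.

Lemma qmul_conj0 (v : H) : im (qmul (qconj 0) v) = 0.
Proof. by apply: quatP; rewrite !mkqE /re /ci /cj /ck !mxE; ring. Qed.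

Lemma cvg_instanton_ASD (lambda : R) : 0 < lambda ->
  exists delta : R -> R,
    [/\ forall x1, 0 <= x1 -> 0 < delta x1,
        delta x1 @[x1 --> +oo] --> 0 &
        forall p : H, S3 p ->
          cvg_Coo (ball4 1)
            (fun x1 => pullback (s_map (delta x1) p) (on_M (theta A B T x1)))
            (pinfty_nbhs R) (theta_ASD T lambda)].
Proof.
move=> l0; have i00 := i_gt0 0 (lexx 0).
(* Both profiles are normalised to be 1 at 0. The choice of scale below then turns x_1 s i(s), at s
   = [eps x1 * qnorm2 x], into [lambda * qnorm2 x * i1 s]. *)
pose i1 s := (i 0)^-1 * i s; pose j1 s := (i 0)^-1 * j s.
have si1 : hsmooth i1 by apply: hsmoothM => //; exact: hsmooth_cst.
have sj1 : hsmooth j1 by apply: hsmoothM => //; exact: hsmooth_cst.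
have i1_gt0 s : 0 <= s -> 0 < i1 s.
  by move=> s0; rewrite mulr_gt0 ?invr_gt0 ?i_gt0.
(* The scale is chosen so that [x1 * delta ^+ 2 * i 0 = lambda]. *)
pose eps x1 := if 0 < x1 then lambda / (x1 * i 0) else 1.
(* The default value 1 keeps the scale positive at [x1 = 0]. *)
have eps_gt0 x1 : 0 < eps x1.
  by rewrite /eps; case: ifP => // x10; rewrite divr_gt0// mulr_gt0.
have ceps : eps x1 @[x1 --> +oo] --> (0 : R)^'+.
  move=> P [r /= r0 rP].
  suff H : \forall x1 \near +oo, P (eps x1) by exact: H.
  near=> x1.
  apply: rP; last exact: eps_gt0.
  rewrite /= sub0r normrN gtr0_norm// /eps.
  have x10 : 0 < x1 by near: x1; exact: nbhs_pinfty_gt.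
  have : lambda / (i 0 * r) < x1.
    by near: x1; apply: nbhs_pinfty_gt; exact: num_real.
  by rewrite x10 !ltr_pdivrMr ?mulr_gt0// (mulrC r) -mulrA.
exists (fun x1 => Num.sqrt (eps x1)); split.
- by move=> x1 _; rewrite sqrtr_gt0.
- have ceps0 : eps x1 @[x1 --> +oo] --> (0 : R).
    by apply: cvg_trans ceps _; exact: cvg_within.
  have := cvg_comp _ _ ceps0 (@sqrt_continuous R 0).
  by rewrite sqrtr0.
move=> p p1.
(* The components of Im(conj(x) dx) are linear in [x], hence expressions independent of the
   scale. *)
have [E EE] : exists E : 'I_4 -> 'I_4 -> expr, forall k l eps x,
    den lambda i1 eps (E k l) x = im (qmul (qconj x) (e_ k)) 0 l.
  have /choice[E EE] (kl : 'I_4 * 'I_4) : exists E : expr, forall eps x,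
      den lambda i1 eps E x = im (qmul (qconj x) (e_ kl.1)) 0 kl.2.
    have [c cE] := im_coord (e_ kl.1) kl.2.
    exists (Add (Add (Add (Mul (Cst (c 0)) (Crd 0)) (Mul (Cst (c 1)) (Crd 1)))
      (Mul (Cst (c 2)) (Crd 2))) (Mul (Cst (c 3)) (Crd 3))) => ? x.
    by rewrite cE.
  by exists (fun k l => E (k, l)) => k l; exact: EE.
pose F k l := Mul (Mul (Mul (Cst lambda) (Rad j1 sj1)) Quo) (E k l).
have FE e k x : vden lambda i1 e (F k) x = (lambda * j1 (e * qnorm2 x)
    / (1 + lambda * qnorm2 x * i1 (e * qnorm2 x))) *: im (qmul (qconj x) (e_ k)).
  by apply/rowP => l; rewrite !mxE /= EE mxE.
apply: (cvg_Coo_vden lambda i1 l0 si1 i1_gt0 eps _ _ F ceps); last first.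
  move=> k; apply/funext => x; rewrite FE theta_ASD_E// mul0r /i1 /j1 ji0.
  by rewrite mulVf ?gt_eqF// !mulr1.
near=> x1 => k; apply/funext => x; rewrite FE.
have x10 : 0 < x1 by near: x1; exact: nbhs_pinfty_gt.
have [->|x0] := eqVneq x 0.
  by rewrite qmul_conj0 scaler0 /pullback derive_s_map /on_M /= scaler0 eqxx.
rewrite pullback_conn_plusE ?sqrtr_gt0//; congr (_ *: _).
have n0 := qnorm_gt0 x x0.
set t := Num.sqrt (eps x1) * qnorm x; have t0 : 0 < t by rewrite mulr_gt0// sqrtr_gt0.
rewrite -(mulrA x1) AexpE// intE//.
have -> : t ^+ 2 = eps x1 * qnorm2 x.
  by rewrite /t exprMn sqr_sqrtr ?ltW// qnormE.
have n20 : 0 < qnorm2 x by rewrite -qnormE exprn_gt0.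
rewrite qnormE; have ip : 0 < i (eps x1 * qnorm2 x).
  by rewrite i_gt0// mulr_ge0 ?ltW.
rewrite /i1 /j1; set s := eps x1 * _ in ip *.
have sE : x1 * eps x1 = lambda / i 0.
  by rewrite /eps x10; field; rewrite !gt_eqF.
rewrite !mulrA !sE.
have d2 : i 0 + lambda * qnorm2 x * i s != 0.
  by rewrite lt0r_neq0// addr_gt0 ?mulr_gt0.
by field; rewrite d2 !gt_eqF.
Unshelve. all: by end_near. Qed.

Variable N : H -> R.
Hypotheses (N_norm : Ad_invariant_norm N) (A_gt0 : forall t, 0 < t -> 0 < A t)
  (sA : hsmooth A).

Lemma qnormM (p q : H) : qnorm (qmul p q) = qnorm p * qnorm q.
Proof.
apply/eqP; rewrite -(eqrXn2 (n := 2)) ?mulr_ge0 ?qnorm_ge0// exprMn.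
by rewrite !sqr_qnorm !mkqE; apply/eqP; ring.
Qed.

Lemma qnorm_conj (p : H) : qnorm (qconj p) = qnorm p.
Proof.
apply/eqP; rewrite -(eqrXn2 (n := 2)) ?qnorm_ge0//.
by rewrite !sqr_qnorm !mkqE; apply/eqP; ring.
Qed.

Lemma chart_S3 (z : H * H) : Mreg z -> S3 (chart z).2.1 /\ S3 (chart z).2.2.
Proof.
case: z => x p [/= x0 p1]; have S := S3_radial x x0.
split => //; rewrite /S3 /= qnormM qnorm_conj (p1 : qnorm p = 1) mul1r.
exact: S.
Qed.

(** Only the three frame vectors T_i^+ / (2A) contribute; the factor 7 comes from bounding each of
    the 7 frame terms by the same quantity. *)
Lemma form_norm_conn_plus (f : R -> R) (y : R * (H * H)) :
  S3 y.2.1 -> S3 y.2.2 ->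
  form_norm A B T N (conn_plus T f) y
    <= `|(2 * A y.1)^-1 * f y.1| * Num.sqrt (7 * \sum_(l < 3) N (tnth T l) ^+ 2).
Proof.
move=> s1 s2; have [T0 fT _ _ _] := T_std; have [_ NZ _ _] := N_norm.
set k := _^-1 * _; set S := \sum_(l < 3) _.
have S0 : 0 <= S by apply: sumr_ge0 => l _; exact: sqr_ge0.
have kS : 0 <= k ^+ 2 * S by rewrite mulr_ge0// sqr_ge0.
have N0 : N 0 = 0.
  by rewrite -(scale0r (0 : H)) NZ ?normr0 ?mul0r// /su2 /= /re mxE.
rewrite /form_norm -sqrtr_sqr -sqrtrM ?sqr_ge0//; apply: ler_wsqrtr.
have -> : k ^+ 2 * (7 * S) = \sum_(l < 1 + (3 + 3)) k ^+ 2 * S.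
  by rewrite sumr_const card_ord -[RHS]mulr_natr; ring.
apply: ler_sum => l _; rewrite /frame; case: (fintype.splitP l) => l' _ /=.
  rewrite /conn_plus big1 ?scaler0 ?N0 ?expr0n// => m _.
  by rewrite /eta_plus eta_dt scale0r.
have D (c : R) (m : 'I_(3 + 3)) :
    conn_plus T f y (0, c *: pairmul y.2 (tnth (Tpm T) m))
    = f y.1 *: \sum_(q < 3) (c * (m == lshift 3 q)%:R) *: tnth T q.
  by congr (_ *: _); apply: eq_bigr => q _; rewrite /eta_plus eta_Tpm.
rewrite D; case: (split_ordP l') => m ->.
  rewrite (bigD1 m)//= big1 ?addr0 => [|q qm]; last first.
    by rewrite eq_lshift eq_sym (negPf qm) mulr0 scale0r.
  rewrite eqxx mulr1 scalerA NZ// exprMn real_normK ?num_real//.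
  rewrite [f _ * _]mulrC -/k ler_wpM2l ?sqr_ge0// /S (bigD1 m)//= lerDl.
  by apply: sumr_ge0 => q _; exact: sqr_ge0.
rewrite big1 ?scaler0 ?N0 ?expr0n// => q _.
by rewrite eq_rlshift mulr0 scale0r.
Qed.

Lemma cvg_theta0 (K : set (H * H)) : compact K -> K `<=` Mreg ->
  forall e : R, 0 < e -> \forall x1 \near +oo, forall z, K z ->
    form_norm A B T N
      (fun y w => theta A B T x1 y w - theta0 A B T y w) (chart z) < e.
Proof.
move=> cK KM e e0.
(* With I the integral of [expF], the two coefficients differ by - A expF / (I (1 + x_1 I)). Divided
   by 2 A, this is at most [g t / x1] in absolute value, [g] being A expF / (2 A I^2). *)
pose g (t : R) := j (t ^+ 2) * ((2 * A t * t ^+ 2)^-1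
  * ((i (t ^+ 2))^-1 * (i (t ^+ 2))^-1)).
have cg t : 0 < t -> {for t, continuous g}.
  move=> t0; have t20 : 0 < t ^+ 2 by rewrite exprn_gt0.
  have c2 : {for t, continuous (fun t : R => t ^+ 2)} by exact: exprn_continuous.
  have ci2 : {for t, continuous (fun t : R => i (t ^+ 2))}.
    apply: continuous_comp => //; apply: hcont_continuous => //.
    by apply: hsmooth_hcont => //; exact: ltW.
  have cj2 : {for t, continuous (fun t : R => j (t ^+ 2))}.
    apply: continuous_comp => //; apply: hcont_continuous => //.
    by apply: hsmooth_hcont => //; exact: ltW.
  have cA : {for t, continuous A}.
    by apply: hcont_continuous => //; apply: hsmooth_hcont => //; exact: ltW.
  have ciV : {for t, continuous (fun t : R => (i (t ^+ 2))^-1)}.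
    by apply: continuousV => //; rewrite gt_eqF ?i_gt0// ltW.
  apply: continuousM => //; apply: continuousM; last exact: continuousM.
  apply: continuousV; first by rewrite !mulf_neq0 ?gt_eqF ?A_gt0.
  by apply: continuousM => //; apply: continuousM => //; exact: cst_continuous.
(* [K] avoids the singular orbit, so the distance to it stays positive on [K] and [g] of it is
   continuous there. *)
have [M [_ gM]] : bounded_set ((g \o qnorm \o fst) @` K).
  apply: compact_bounded; apply: continuous_compact cK.
  apply: continuous_in_subspaceT => z /set_mem /KM [z0 _].
  apply: continuous_comp; first exact: cvg_fst.
  apply: continuous_comp; last by apply: cg; exact: qnorm_gt0.
  by apply: differentiable_continuous; have [] := has_diff_qnorm z.1 z0.
have {}gM z : K z -> `|g (qnorm z.1)| <= `|M| + 1.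
  move=> Kz; apply: (gM (`|M| + 1)); last by exists z.
  by rewrite (le_lt_trans (ler_norm _))// ltrDl.
set S := Num.sqrt (7 * \sum_(l < 3) N (tnth T l) ^+ 2).
have S0 : 0 <= S by exact: sqrtr_ge0.
near=> x1 => z Kz.
have x10 : 0 < x1 by near: x1; exact: nbhs_pinfty_gt.
have [z0 z1] := KM _ Kz; have [s1 s2] := chart_S3 z (KM _ Kz).
pose f t := x1 * A t * expF A B t / (1 + x1 * oint 0 t (expF A B))
  - A t * expF A B t / oint 0 t (expF A B).
have -> : (fun y w => theta A B T x1 y w - theta0 A B T y w) = conn_plus T f.
  by apply/funext => y; apply/funext => w; rewrite /conn_plus -scalerBl.
apply: le_lt_trans (form_norm_conn_plus f _ s1 s2) _; rewrite -/S.
have -> : (chart z).1 = qnorm z.1 by [].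
have t0 := qnorm_gt0 _ z0; have := gM z Kz.
move: (qnorm z.1) t0 => t t0 gt.
have k : `|(2 * A t)^-1 * f t| <= `|g t| / x1.
  have At := A_gt0 t t0; have t20 : 0 < t ^+ 2 by rewrite exprn_gt0.
  have it : 0 < i (t ^+ 2) by rewrite i_gt0// ltW.
  have P0 : 0 < t ^+ 2 * i (t ^+ 2) by rewrite mulr_gt0.
  have P1 : 0 < 1 + x1 * (t ^+ 2 * i (t ^+ 2)) by rewrite addr_gt0// mulr_gt0.
  have -> : (2 * A t)^-1 * f t = - g t / x1
      * (x1 * (t ^+ 2 * i (t ^+ 2)) / (1 + x1 * (t ^+ 2 * i (t ^+ 2)))).
    rewrite /f /g -(mulrA x1) AexpE// intE//; field.
    by rewrite !gt_eqF.
  rewrite normrM normrM normrN (gtr0_norm (_ : 0 < x1^-1)) ?invr_gt0//.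
  rewrite ler_piMr ?mulr_ge0 ?invr_ge0 ?(ltW x10)//.
  rewrite ger0_norm ?divr_ge0 ?(ltW P1) ?mulr_ge0 ?(ltW t20) ?(ltW t0) ?(ltW it) ?(ltW x10)//.
  by rewrite ler_pdivrMr// mul1r lerDr.
apply: (@le_lt_trans _ _ ((`|M| + 1) / x1 * S)).
  by rewrite ler_wpM2r// (le_trans k)// ler_wpM2r// invr_ge0 ltW.
rewrite mulrAC ltr_pdivrMr// mulrC -ltr_pdivrMl// mulrC.
by near: x1; apply: nbhs_pinfty_gt; exact: num_real.
Unshelve. all: by end_near. Qed.

End Bubbling.

Theorem theorem4p14 (R : realType) (A B : R -> R) (b0 : R)
    (T : 3.-tuple (quat R)) (N : quat R -> R)
    (hA_smooth : hsmooth A) (hA_pos : forall t, 0 < t -> 0 < A t)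
    (hA_odd : odd_at0 A) (hA_deriv : hderive A 0 = 2^-1)
    (hb0 : 0 < b0)
    (hB_smooth : hsmooth B) (hB_pos : forall t, 0 <= t -> 0 < B t)
    (hB_even : even_at0 B) (hB_init : B 0 = b0)
    (hB_ode : forall t, 0 <= t ->
       hderive (fun s => A s ^+ 2 * B s ^+ 2) t = A t ^+ 3 + A t * B t ^+ 2)
    (hT : standard_basis T) (hN : Ad_invariant_norm N) :
  (forall lambda : R, 0 < lambda ->
     exists delta : R -> R,
       [/\ forall x1, 0 <= x1 -> 0 < delta x1,
           delta x1 @[x1 --> +oo] --> 0 &
           forall p : quat R, S3 p ->
             cvg_Coo (ball4 1)
               (fun x1 => pullback (s_map (delta x1) p) (on_M (theta A B T x1)))
               (pinfty_nbhs R)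
               (theta_ASD T lambda)])
  /\
  (bounded_off_singular A B T N (theta0 A B T) ->
     forall K : set (quat R * quat R), compact K -> K `<=` Mreg ->
     forall e : R, 0 < e ->
       \forall x1 \near +oo, forall z, K z ->
         form_norm A B T N
           (fun y w => theta A B T x1 y w - theta0 A B T y w) (chart z) < e).
Proof.
have [i [j [[si sj] ji0 i_gt0 intE AexpE]]] :=
  profile A B hA_smooth hA_pos hA_odd hA_deriv hB_smooth hB_pos hB_even.
split=> [lambda l0|_ K cK KM e e0].
  exact: (cvg_instanton_ASD A B T i j).
exact: (cvg_theta0 A B T i j).
Qed.
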